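(* Setting: $Y_i=f_0(X_i)+\epsilon_i$, $i=1,\dots,n$, with $X_i$ i.i.d. from $P$ on a compact $\mathcal{X}\subset\mathbb{R}^d$, $\epsilon_i$ i.i.d. with $E[\epsilon]=0$ and $\int_0^\infty(\mathbb{P}(|\epsilon|>t))^{1/p}dt<\infty$ for some $p\ge2$. Let $r_n,V_n,M_n\to\infty$ with $V_n>1$, $M_n>0$, and $$\mathcal{F}_{r_n}=\Big\{\alpha_0+\sum_{j=1}^{r_n}\alpha_j\tanh(\gamma_j^Tx+\gamma_{0,j}):\gamma_j\in\mathbb{R}^d,\ \alpha_j,\gamma_{0,j}\in\mathbb{R},\ \sum_{j=0}^{r_n}|\alpha_j|\le V_n,\ \max_{1\le j\le r_n}\sum_{i=0}^d|\gamma_{i,j}|\le M_n\Big\},$$ with $\gamma_{i,j}$ ($1\le i\le d$) the components of $\gamma_j$. Assume $\mathcal{F}_{r_n}\subset\mathcal{F}_{r_{n+1}}$, $f_0\in\mathcal{F}$ and there is $\pi_nf_0\in\mathcal{F}_{r_n}$ with $\sup_{x\in\mathcal{X}}|\pi_nf_0(x)-f_0(x)|\to0$. Let $J_n(f)=\sum_{j=0}^{r_n}|\alpha_j|+\sum_{i=0}^d\sum_{j=1}^{r_n}|\gamma_{i,j}|$ and let $\hat f_n\in\mathcal{F}_{r_n}$ satisfy $\tilde{\mathbb{Q}}_n(\hat f_n)\le\inf_{f\in\mathcal{F}_{r_n}}\tilde{\mathbb{Q}}_n(f)+O(\eta_n)$ with $\eta_n\to0$, where $\tilde{\mathbb{Q}}_n(f)=\frac1n\sum_{i=1}^n(f(X_i)-Y_i)^2+\lambda_nJ_n(f)$.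 Assume $$r_nV_n^2\log(r_nV_n)=o(n)\quad\text{as }n\to\infty.$$ Then for any $\delta>0$ there exists $\nu>0$ such that, if $\lambda_n=o\big(r_n^{-1/2}\wedge r_n^{-(\nu-1)/(2\nu)}\big)$, then $\|\hat f_n-f_0\|_n\to0$ as $n\to\infty$ with probability at least $1-\delta$.
   Context: $\|g\|_n^2=\frac1n\sum_{i=1}^ng(X_i)^2$ is the empirical norm; $a\wedge b=\min(a,b)$.
   Formalization: The noise variables ε_i are assumed independent of the design points X_i (all X_i, ε_i mutually independent), without which the claim fails (e.g. ε_i = X_i − 1/2, f_0 = 0); the penalty weights λ_n are assumed nonnegative. *)

(* Defs.v *)
From HB Require Import structures.
From mathcomp Require Import all_boot all_order all_algebra.
From mathcomp Require Import all_classical all_reals all_analysis.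
Unset Printing Implicit Defensive.
Import Order.TTheory GRing.Theory Num.Theory.
Import numFieldNormedType.Exports.
Local Open Scope classical_set_scope.
Local Open Scope ring_scope.

Definition tanh {R : realType} (x : R) : R :=
  (expR x - expR (- x)) / (expR x + expR (- x)).

(* parameters of a one-hidden-layer tanh network:
   alpha j  (j = 0..r)  output weights (alpha 0 = intercept),
   gamma i j (i = 0..d, j = 1..r): gamma 0 j = bias gamma_{0,j},
   gamma i j (1 <= i <= d) = i-th component of gamma_j. *)
Record nnparam (R : realType) := NNParam {
  nn_alpha : nat -> R;
  nn_gamma : nat -> nat -> R }.
Arguments nn_alpha {R}.
Arguments nn_gamma {R}.

Definition net {R : realType} (d r : nat) (th : nnparam R) (x : 'rV[R]_d) : R :=
  nn_alpha th 0 + \sum_(1 <= j < r.+1)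
     nn_alpha th j * tanh (\sum_(i < d) nn_gamma th i.+1 j * x ord0 i + nn_gamma th 0 j).

Definition admissible {R : realType} (d r : nat) (V M : R) (th : nnparam R) : Prop :=
  \sum_(0 <= j < r.+1) `|nn_alpha th j| <= V /\
  (forall j, (1 <= j <= r)%N -> \sum_(0 <= i < d.+1) `|nn_gamma th i j| <= M).

Definition Fnet {R : realType} (d r : nat) (V M : R) : set ('rV[R]_d -> R) :=
  [set f | exists th, admissible d r V M th /\ f = net d r th].

Definition Jpen {R : realType} (d r : nat) (th : nnparam R) : R :=
  \sum_(0 <= j < r.+1) `|nn_alpha th j|
  + \sum_(0 <= i < d.+1) \sum_(1 <= j < r.+1) `|nn_gamma th i j|.

Definition Qtilde {R : realType} (d r n : nat) (lam : R)
    (Xs : nat -> 'rV[R]_d) (Ys : nat -> R) (th : nnparam R) : R :=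
  n%:R^-1 * \sum_(i < n) (net d r th (Xs i) - Ys i) ^+ 2 + lam * Jpen d r th.

Definition Qinf {R : realType} (d r n : nat) (V M lam : R)
    (Xs : nat -> 'rV[R]_d) (Ys : nat -> R) : R :=
  inf [set Qtilde d r n lam Xs Ys th | th in admissible d r V M].

Definition emp_norm {R : realType} (d n : nat) (Xs : nat -> 'rV[R]_d)
    (g : 'rV[R]_d -> R) : R :=
  Num.sqrt (n%:R^-1 * \sum_(i < n) (g (Xs i)) ^+ 2).

Section Prob.
Context {R : realType} {d0 : measure_display} {Omega : measurableType d0}.

Definition mutual_indep {I : eqType} (P : probability Omega R)
    (C : I -> set (set Omega)) : Prop :=
  forall (s : seq I), uniq s -> forall E : I -> set Omega,
    (forall i, i \in s -> C i (E i)) ->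
    P (\big[setI/setT]_(i <- s) E i) = (\prod_(i <- s) P (E i))%E.

Definition rect_events (d : nat) (X : 'I_d -> Omega -> R) : set (set Omega) :=
  [set A | exists B : 'I_d -> set R, (forall j, measurable (B j)) /\
           A = \big[setI/setT]_(j < d) (X j @^-1` B j)].

Definition rv_events (Z : Omega -> R) : set (set Omega) :=
  [set Z @^-1` B | B in measurable].
End Prob.

(* Main.v *)
(* The penalized estimator satisfies, for any fixed competitor g in the sieve, the basic
   inequality
     |fhat - f0|_n^2 <= |g - f0|_n^2 + (2/n) sum_i eps_i (fhat - g)(X_i) + lam_n J(g) + C eta_n.
   Taking for g a fixed approximation of f0, padded with zero weights, makes J(g) constant,
   so that lam_n J(g) -> 0 and only the noise term matters; the choice of nu is irrelevant.

   A network is an l1-combination of neurons, and tanh is monotone, so by Abel summation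
   |sum_i eps_i f(X_i)| <= 3 V_n T_n on the whole sieve as soon as |sum_(i in A) eps_i| <= T_n
   for every trace A of a half-space on the sample; by Sauer-Shelah there are at most
   (n+1)^(d+1) of them.  Since the noise is independent of the design, a union bound works
   with one tail estimate per trace.  As only two moments are available, the tail estimate
   is self-normalized: exp(x - x^2) <= 1 + x + x^2 bounds
   E exp(lam S - lam^2 sum eps_i^2), and sum_(i < n) eps_i^2 <= B n holds for all n at once
   with probability at least 1 - delta by Garsia's maximal lemma.  Borel-Cantelli then gives
   T_n = O(sqrt(n log n)) eventually, and the growth condition forces
   V_n^2 log n = o(n). *)
Require Import Defs.
From HB Require Import structures.
From mathcomp Require Import all_boot all_order all_algebra.
From mathcomp Require Import ring lra zify.
Import Order.TTheory GRing.Theory Num.Theory.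
Set Implicit Arguments.
Unset Strict Implicit.
Local Open Scope ring_scope.

(** * The Sauer-Shelah lemma *)

Section sauer_shelah.
Local Open Scope nat_scope.
Variable T : finType.
Implicit Types (F : {set {set T}}) (S A : {set T}).

Definition shatters F S :=
  [forall A : {set T}, (A \subset S) ==> [exists B in F, B :&: S == A]].

Lemma shattersP F S :
  reflect (forall A, A \subset S -> exists2 B, B \in F & B :&: S = A)
          (shatters F S).
Proof.
apply: (iffP forallP) => [h A AS|h A].
  by have /implyP/(_ AS)/existsP[B /andP[BF /eqP]] := h A; exists B.
apply/implyP => /h[B BF BS]; apply/existsP; exists B.
by rewrite BF BS eqxx.
Qed.

Lemma shatters_sub F F' S : F \subset F' -> shatters F S -> shatters F' S.
Proof.
move=> /subsetP FF' /shattersP h; apply/shattersP => A /h[B BF BS].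
by exists B => //; exact: FF'.
Qed.

(* Pajor's form of the Sauer-Shelah lemma. *)
Lemma card_le_shattered F : #|F| <= #|[set S | shatters F S]|.
Proof.
move: {2}#|F|.+1 (ltnSn #|F|) => n; elim: n F => // n IH F; rewrite ltnS => Fn.
have [/card_le1_eqP F1|/card_gt1P[A [B [AF BF AB]]]] := leqP #|F| 1.
  have [->|/set0Pn[A AF]] := eqVneq F set0; first by rewrite cards0.
  have -> : F = [set A].
    apply/setP => C; rewrite inE; apply/idP/eqP => [CF|->//].
    exact: F1.
  rewrite cards1; apply/card_gt0P; exists set0; rewrite inE.
  apply/shattersP => C; rewrite subset0 => /eqP ->.
  by exists A; rewrite ?inE// setI0.
(* Two distinct members of [F] are separated by some [x]; the members containing [x] and the others
   form two nonempty, hence strictly smaller, families. *)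
have [x xAB] : exists x, (x \in A) != (x \in B).
  apply/existsP; apply: contraR AB; rewrite negb_exists => /forallP h.
  by apply/eqP/setP => x; have := h x; rewrite negbK => /eqP.
pose F1 := [set C in F | x \in C]; pose F0 := F :\: F1.
have F1F : F1 \subset F by apply/subsetP => C; rewrite inE => /andP[].
have F0F : F0 \subset F by exact: subsetDl.
have cF : #|F| = #|F1| + #|F0| by rewrite -(cardsID F1 F) (setIidPr F1F).
have [F1p F0p] : 0 < #|F1| /\ 0 < #|F0|.
  split; apply/card_gt0P.
    by case xA: (x \in A) xAB => /= xB; [exists A|exists B]; rewrite !inE ?AF ?BF ?xA//;
       case: (x \in B) xB.
  by case xA: (x \in A) xAB => /= xB; [exists B|exists A]; rewrite !inE ?AF ?BF ?xA//;
     case: (x \in B) xB.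
have h1 : #|F1| <= #|[set S | shatters F1 S]| by apply: IH; lia.
have h0 : #|F0| <= #|[set S | shatters F0 S]| by apply: IH; lia.
have xN1 S : shatters F1 S -> x \notin S.
  move=> /shattersP h; apply/negP => xS.
  have [C] := h set0 (sub0set _); rewrite inE => /andP[_ xC] /setP/(_ x).
  by rewrite !inE xC xS.
have xN0 S : shatters F0 S -> x \notin S.
  move=> /shattersP h; apply/negP => xS.
  have [C] := h S (subxx _); rewrite !inE => /andP[xC CF] /setP/(_ x).
  by rewrite !inE xS andbT; case: (x \in C) xC => //; rewrite CF.
set s1 := [set S | shatters F1 S] in h1; set s0 := [set S | shatters F0 S] in h0.
(* A set shattered by both halves counts twice: [F] shatters it and also its union with [x], whereas
   neither half shatters a set containing [x]. *)
pose s01 := [set x |: S | S in s1 :&: s0].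
have cs : #|s01| = #|s1 :&: s0|.
  apply: card_in_imset => S S'; rewrite !inE => /andP[/xN1 h _] /andP[/xN1 h' _].
  by move/(congr1 (fun A => A :\ x)); rewrite !setU1K.
have dis : [disjoint s1 :|: s0 & s01].
  apply/pred0P => S /=; apply/negP => /andP[Sm /imsetP[S' _ SE]]; move: Sm; rewrite SE.
  by rewrite !inE => /orP[/xN1|/xN0]; rewrite !inE eqxx.
have sub : (s1 :|: s0) :|: s01 \subset [set S | shatters F S].
  apply/subsetP => S; rewrite !inE => /orP[/orP[]|].
  - exact: shatters_sub.
  - exact: shatters_sub.
  move=> /imsetP[S' + ->]; rewrite !inE => /andP[sh1 sh0].
  apply/shattersP => C CS.
  have CxS : C :\ x \subset S'.
    by apply/subsetP => y; rewrite !inE => /andP[yx /(subsetP CS)]; rewrite !inE (negbTE yx).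
  have [xC|xC] := boolP (x \in C).
    have /shattersP/(_ _ CxS)[D] := sh1; rewrite inE => /andP[DF xD] DS.
    by exists D => //; rewrite setIUr DS (setIidPr _) ?sub1set// setD1K.
  have /shattersP/(_ _ CxS)[D] := sh0; rewrite !inE negb_and => /andP[xD DF] DS.
  exists D => //; rewrite setIUr DS.
  have -> : D :&: [set x] = set0.
    by apply/eqP; rewrite setI_eq0 disjoint_sym disjoints1; move: xD; rewrite DF.
  rewrite set0U; apply/setP => y; rewrite !inE; case: eqVneq => // -> /=.
  by rewrite (negbTE xC).
have := subset_leq_card sub.
rewrite (cardsU (s1 :|: s0)) (disjoint_setI0 dis) cards0 subn0 cs.
have := cardsUI s1 s0; lia.
Qed.

Lemma card_small_subsets k :
  #|[set S : {set T} | #|S| <= k]| <= #|T|.+1 ^ k.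
Proof.
pose f (g : {ffun 'I_k -> option T}) : {set T} := [set x | Some x \in codom g].
have -> : #|T|.+1 ^ k = #|{ffun 'I_k -> option T}|.
  by rewrite card_ffun card_option card_ord.
apply: (@leq_trans #|f @: [set: {ffun 'I_k -> option T}]|); last first.
  by rewrite (leq_trans (leq_imset_card _ _))// cardsT.
apply/subset_leq_card/subsetP => S; rewrite inE => Sk.
apply/imsetP; exists [ffun i : 'I_k => nth None (map Some (enum S)) i] => //.
apply/setP => x; rewrite inE; apply/idP/codomP => [xS|[i]].
  have xi : index x (enum S) < k.
    by rewrite (leq_trans _ Sk)// cardE index_mem mem_enum.
  exists (Ordinal xi); rewrite ffunE /= (nth_map x) ?index_mem ?mem_enum//.
  by rewrite nth_index// mem_enum.
rewrite ffunE => xE; have [iS|iS] := ltnP i (size (enum S)).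
  by move: xE; rewrite (nth_map x)// => -[->]; rewrite -mem_enum mem_nth.
by move: xE; rewrite nth_default// size_map.
Qed.

End sauer_shelah.

(** * Traces of half-spaces on a finite sample *)

Section halfspaces.
Variables (R : realFieldType) (n d : nat) (x : 'I_n -> 'I_d -> R).

(** Radon's argument: more than [d + 1] points in dimension [d] carry a nontrivial affine
    dependence, and a half-space cutting out exactly the points with positive coefficients would
    make this dependence positive. *)
Lemma shattered_by_halfspaces (F : {set {set 'I_n}}) (S : {set 'I_n}) :
  (forall A, A \in F -> exists (g : 'I_d -> R) (b : R),
     forall i, (i \in A) = (0 < \sum_j g j * x i j + b)) ->
  shatters F S -> (#|S| <= d.+1)%N.
Proof.
move=> FH /shattersP sh; rewrite leqNgt; apply/negP => Sd.
pose y (k : 'I_#|S|) : 'I_n := enum_val k.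
pose Phi : 'M[R]_(#|S|, 1 + d) :=
  row_mx (const_mx 1) (\matrix_(k, j) x (y k) j).
have /rowV0Pn[c /sub_kermxP cPhi c0] : kermx Phi != 0.
  rewrite kermx_eq0 /row_free neq_ltn (leq_ltn_trans (rank_leq_col _))//.
have aff (g : 'I_d -> R) b :
    \sum_k c 0 k * (\sum_j g j * x (y k) j + b) = 0.
  move: cPhi; rewrite /Phi mul_mx_row -[0]row_mx0 => /eq_row_mx[c1 cx].
  have c1' : \sum_k c 0 k = 0.
    have /matrixP/(_ 0 0) := c1; rewrite !mxE => h; rewrite -[RHS]h.
    by apply: eq_bigr => k _; rewrite mxE mulr1.
  have cx' j : \sum_k c 0 k * x (y k) j = 0.
    have /matrixP/(_ 0 j) := cx; rewrite !mxE => h; rewrite -[RHS]h.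
    by apply: eq_bigr => k _; rewrite mxE.
  under eq_bigr do rewrite mulrDr.
  rewrite big_split /= -mulr_suml c1' mul0r addr0.
  under eq_bigr do rewrite mulr_sumr.
  rewrite exchange_big big1//= => j _.
  under eq_bigr do rewrite mulrCA.
  by rewrite -mulr_sumr cx' mulr0.
have contra (a : 'I_#|S| -> R) (k0 : 'I_#|S|) : 0 < a k0 ->
    (forall g b, \sum_k a k * (\sum_j g j * x (y k) j + b) = 0) -> False.
  move=> ak0 a0.
  pose A := [set y k | k in [pred k | 0 < a k]].
  have AS : A \subset S.
    by apply/subsetP => i /imsetP[k _ ->]; exact: enum_valP.
  have [B /FH[g [b Bgb]] BS] := sh A AS.
  have kB k : (y k \in B) = (0 < a k).
    have /setP/(_ (y k)) := BS; rewrite inE (enum_valP k) andbT => ->.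
    apply/imsetP/idP => [[k' ak' /enum_val_inj ->]//|ak].
    by exists k.
  (* Points with a positive coefficient lie in the half-space and the others outside it, so no term
     is negative and that of [k0] is positive. *)
  have := a0 g b; apply/eqP; rewrite gt_eqF//.
  rewrite (bigD1 k0)//= ltr_pwDl//.
    by rewrite mulr_gt0// -Bgb kB.
  rewrite sumr_ge0// => k _; have [ak|ak] := ltP 0 (a k).
    by rewrite ltW// mulr_gt0// -Bgb kB.
  by rewrite mulr_le0// leNgt -Bgb kB -leNgt.
have [k ck] : exists k, c 0 k != 0.
  apply/existsP; apply: contraR c0; rewrite negb_exists => /forallP h.
  by apply/eqP/rowP => k; have := h k; rewrite negbK mxE => /eqP.
(* If the nonzero coefficient is negative, the opposite dependence is used. *)
have [cp|cn] := ltP 0 (c 0 k); first exact: (contra (c 0) k).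
apply: (contra (fun k => - c 0 k) k).
  by rewrite oppr_gt0 lt_neqAle ck.
move=> g b; apply/eqP; rewrite -oppr_eq0 -sumrN; apply/eqP.
by rewrite -[RHS](aff g b); apply: eq_bigr => ? _; rewrite mulNr opprK.
Qed.

Lemma card_halfspace_patterns (F : {set {set 'I_n}}) :
  (forall A, A \in F -> exists (g : 'I_d -> R) (b : R),
     forall i, (i \in A) = (0 < \sum_j g j * x i j + b)) ->
  (#|F| <= n.+1 ^ d.+1)%N.
Proof.
move=> FH; rewrite (leq_trans (card_le_shattered F))//.
have := card_small_subsets 'I_n d.+1; rewrite card_ord; apply: leq_trans.
apply/subset_leq_card/subsetP => S; rewrite !inE.
exact: shattered_by_halfspaces.
Qed.

End halfspaces.

(* Abel summation: [v] is a nonnegative combination, of total mass at most [c],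
   of indicators of its superlevel sets. *)
Lemma abel_superlevel (R : realFieldType) (I : finType) (e v : I -> R) (c T : R) :
  0 <= T -> 0 <= c -> (forall i, 0 <= v i <= c) ->
  (forall j, 0 < v j -> `|\sum_(i | v j <= v i) e i| <= T) ->
  `|\sum_i e i * v i| <= c * T.
Proof.
move=> T0; pose supp (v : I -> R) := [set i | 0 < v i].
move: {2}#|supp v|.+1 (ltnSn #|supp v|) => n.
elim: n v c => // n IH v c; rewrite ltnS => vn c0 vc vT.
have [s0|/set0Pn[j0 j0s]] := eqVneq (supp v) set0.
  have v0 i : v i = 0.
    apply/eqP; rewrite eq_le (andP (vc i)).1 andbT leNgt.
    by have /setP/(_ i) := s0; rewrite !inE => ->.
  rewrite big1 => [|i _]; last by rewrite v0 mulr0.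
  by rewrite normr0 mulr_ge0.
(* The lowest positive level [v j] is peeled off: this layer is carried by a superlevel set, and the
   remainder [v'] vanishes at [j], so its support is smaller. *)
pose j := [arg min_(i < j0 in supp v) v i]%O.
have [js jmin] : j \in supp v /\ forall i, i \in supp v -> v j <= v i.
  by rewrite /j; case: arg_minP => //.
move: (js); rewrite inE => vj0.
pose v' i := Num.max 0 (v i - v j).
have v'E i : 0 < v i -> v' i = v i - v j.
  by move=> vi; rewrite /v' max_r// subr_ge0 jmin// inE.
have v'0 i : v i <= 0 -> v' i = 0.
  move=> vi; rewrite /v' max_l// subr_le0 (le_trans vi)// ltW//.
have sE : \sum_i e i * v i =
    v j * (\sum_(i | v j <= v i) e i) + \sum_i e i * v' i.
  rewrite mulr_sumr [in RHS]big_mkcond -big_split /=; apply: eq_bigr => i _.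
  have [vi|vi] := ltP 0 (v i).
    by rewrite v'E// jmin ?inE//; ring.
  rewrite v'0// mulr0 addr0 leNgt (le_lt_trans vi)//=.
  suff -> : v i = 0 by rewrite mulr0.
  by apply/eqP; rewrite eq_le vi (andP (vc i)).1.
rewrite sE (le_trans (ler_normD _ _))//.
rewrite (_ : c * T = v j * T + (c - v j) * T); last by ring.
apply: lerD; first by rewrite normrM (gtr0_norm vj0); apply: ler_wpM2l; [exact: ltW|exact: vT].
apply: IH.
- apply: leq_trans vn; apply/proper_card/properP; split.
    apply/subsetP => i; rewrite !inE; apply: contraTT.
    by rewrite -!leNgt => /v'0 ->.
  by exists j => //; rewrite !inE v'E// subrr ltxx.
- by rewrite subr_ge0 (andP (vc j)).2.
- move=> i; rewrite /v' le_max lexx/= ge_max lerB// ?(andP (vc i)).2//.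
  by rewrite subr_ge0 (andP (vc j)).2.
move=> k v'k.
have vk : 0 < v k by rewrite ltNge; apply/negP => /v'0 vk; rewrite vk ltxx in v'k.
(* The superlevel sets of [v'] at its positive levels are superlevel sets of [v]. *)
rewrite (eq_bigl (fun i => v k <= v i)); first exact: vT.
move=> i; rewrite (v'E k)//; have [vi|vi] := ltP 0 (v i).
  by rewrite v'E// lerD2r.
rewrite v'0// leNgt -(v'E k)// v'k; apply/esym/negbTE.
by rewrite -ltNge (le_lt_trans vi).
Qed.

From mathcomp Require Import all_classical all_reals all_analysis.
From mathcomp Require Import measurable_realfun.
Import Order.TTheory GRing.Theory Num.Theory.
Import numFieldNormedType.Exports.
Local Open Scope classical_set_scope.
Local Open Scope ring_scope.

Lemma big_setIP (T : Type) (I : eqType) (s : seq I) (E : I -> set T) w :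
  (\big[setI/setT]_(i <- s) E i) w <-> forall i, i \in s -> E i w.
Proof.
elim: s => [|j s IH]; first by rewrite big_nil.
rewrite big_cons; split => [[Ejw /IH sE] i|sE].
  by rewrite inE => /predU1P[->//|]; exact: sE.
split; first by apply: sE; rewrite mem_head.
by apply/IH => i si; apply: sE; rewrite inE si orbT.
Qed.

(** * Independence of generated sigma-algebras and product formulas *)

Section independence.
Local Open Scope ereal_scope.
Context {R : realType} {d0 : measure_display} {Omega : measurableType d0}.
Variable P : probability Omega R.

Lemma probability_real (A : set Omega) : measurable A ->
  exists a : R, P A = a%:E.
Proof.
by move=> mA; exists (fine (P A)); rewrite fineK// fin_num_measure.
Qed.

(** Dynkin's pi-lambda argument: the measurable events independent of [H] form a lambda-system,
    which contains the pi-system [G]. *)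
Lemma indep_sigma_algebra (G : set (set Omega)) (H : set Omega) :
  setI_closed G -> G `<=` measurable -> measurable H ->
  (forall A, G A -> P (A `&` H) = P A * P H) ->
  forall A, <<s G >> A -> measurable A /\ P (A `&` H) = P A * P H.
Proof.
move=> GI Gm mH GH.
suff : <<s G >> `<=` [set A | measurable A /\ P (A `&` H) = P A * P H] by [].
apply: lambda_system_subset => //; last by move=> A GA; split; [exact: Gm|exact: GH].
apply/dynkin_lambda_system; split.
- by split => //; rewrite setTI probability_setT mul1e.
- move=> A [mA AH]; split; first exact: measurableC.
  rewrite setIC -setDE measureD//; last by rewrite ltey_eq fin_num_measure.
  rewrite probability_setC// (setIC H A); transitivity (P H - P A * P H); first by rewrite -AH.
  have [a ->] := probability_real mA; have [h ->] := probability_real mH.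
  by rewrite -!(EFinM, EFinB) mulrBl mul1r.
- move=> F tF FH; split; first by apply: bigcupT_measurable => k; exact: (FH k).1.
  rewrite setI_bigcupl !measure_bigcup//.
  + have [h hE] := probability_real mH.
    rewrite hE muleC -nneseriesZl//; apply: eq_eseriesr => k _.
    by rewrite muleC -hE; exact: (FH k).2.
  + by move=> k _; exact: (FH k).1.
  + by move=> k _; apply: measurableI => //; exact: (FH k).1.
  + by apply: trivIset_setIr.
Qed.

Variables (I : eqType) (C : I -> set (set Omega)).
Hypothesis indepC : mutual_indep P C.
Hypothesis Cm : forall i, C i `<=` measurable.
Hypothesis CI : forall i, setI_closed (C i).
Hypothesis CT : forall i, C i setT.

(** A pi-system that generates the joint sigma-algebra of the classes indexed by [s]. *)
Definition block_events (s : seq I) : set (set Omega) :=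
  [set A | exists E : I -> set Omega, (forall i, C i (E i)) /\
           A = \big[setI/setT]_(i <- s) E i].

Lemma block_events_setI s : setI_closed (block_events s).
Proof.
move=> _ _ [E [CE ->]] [F [CF ->]]; exists (fun i => E i `&` F i); split.
  by move=> i; exact: CI.
by rewrite big_split.
Qed.

Lemma block_events_measurable s : block_events s `<=` measurable.
Proof.
move=> _ [E [CE ->]]; apply: (big_ind measurable) => //; first exact: measurableI.
by move=> i _; exact/Cm/CE.
Qed.

Lemma block_events1 s i A : i \in s -> C i A -> block_events s A.
Proof.
move=> si CA; exists (fun j => if j == i then A else setT); split.
  by move=> j; case: eqP => [->|].
apply/seteqP; split => [w Aw|w /big_setIP/(_ i si)]; last by rewrite eqxx.
by apply/big_setIP => j _; case: ifP.
Qed.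

(** On rectangles the product formula is mutual independence; the pi-lambda argument then applies
    twice, first to the block [t], then to [s]. *)
Lemma block_events_indep s t G H : uniq (s ++ t) ->
  <<s block_events s >> G -> <<s block_events t >> H ->
  [/\ measurable G, measurable H & P (G `&` H) = P G * P H].
Proof.
move=> st sG tH.
have ut : uniq t by move: st; rewrite cat_uniq => /and3P[].
have us : uniq s by move: st; rewrite cat_uniq => /and3P[].
have key A B : block_events s A -> block_events t B -> P (A `&` B) = P A * P B.
  move=> [E [CE ->]] [F [CF ->]].
  (* As [s] and [t] are disjoint, the two families of events merge into a single one. *)
  pose D i := if i \in s then E i else F i.
  have Ds : \big[setI/setT]_(i <- s) E i = \big[setI/setT]_(i <- s) D i.
    by apply: eq_big_seq => i si; rewrite /D si.
  have Dt : \big[setI/setT]_(i <- t) F i = \big[setI/setT]_(i <- t) D i.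
    apply: eq_big_seq => i ti; rewrite /D; case: ifPn => // si.
    by move: st; rewrite cat_uniq => /and3P[_ /hasPn/(_ _ ti)/=]; rewrite si.
  have CD i : C i (D i) by rewrite /D; case: ifP.
  by rewrite Ds Dt -big_cat !indepC//= big_cat.
have tG A : block_events s A -> P (A `&` H) = P A * P H.
  move=> sA; rewrite setIC muleC.
  apply: (indep_sigma_algebra (G := block_events t) _ _ _ _ tH).2 => //.
  - exact: block_events_setI.
  - exact: block_events_measurable.
  - exact: block_events_measurable sA.
  - by move=> B tB; rewrite setIC muleC; exact: key.
(* Taking the sure event as the other factor yields the measurability of [H] alone. *)
have mH : measurable H.
  apply: (indep_sigma_algebra (G := block_events t) (H := setT) _ _ _ _ tH).1 => //.
  - exact: block_events_setI.
  - exact: block_events_measurable.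
  - by move=> A _; rewrite setIT probability_setT mule1.
have [] := indep_sigma_algebra (@block_events_setI s) (@block_events_measurable s) mH tG sG.
by split.
Qed.

End independence.

Section independent_pair.
Local Open Scope ereal_scope.
Context {R : realType} {d0 d1 d2 : measure_display} {Omega : measurableType d0}
  {T1 : measurableType d1} {T2 : measurableType d2}.
Variable P : probability Omega R.
Variables (U : {mfun Omega >-> T1}) (V : {mfun Omega >-> T2}).
Hypothesis UV : forall A B, measurable A -> measurable B ->
  P (U @^-1` A `&` V @^-1` B) = P (U @^-1` A) * P (V @^-1` B).

Let W w := (U w, V w).
Let mW : measurable_fun setT W.
Proof. exact: measurable_fun_pair. Qed.
HB.instance Definition _ := isMeasurableFun.Build _ _ _ _ W mW.

(** The joint law of [(U, V)] agrees with the product of the marginal laws on rectangles, hence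
    everywhere; Tonelli's theorem concludes. *)
Lemma indep_ge0_integral (f : T1 * T2 -> \bar R) :
  measurable_fun setT f -> (forall z, 0 <= f z) ->
  \int[P]_w f (U w, V w) =
  \int[distribution P U]_x \int[distribution P V]_y f (x, y).
Proof.
move=> mf f0.
rewrite -[LHS](@ge0_integral_distribution _ _ _ _ _ P W f)//.
rewrite -(fubini_tonelli1 f mf f0).
apply: eq_measure_integral => A mA _; apply/esym.
by apply: product_measure_unique => // B D mB mD; rewrite -UV.
Qed.

End independent_pair.

Local Open Scope ereal_scope.

Lemma indep_ge0_expectationM {R : realType} {d0 : measure_display}
    {Omega : measurableType d0} (P : probability Omega R)
    (U V : {mfun Omega >-> R}) :
  (forall A B : set R, measurable A -> measurable B ->
    P (U @^-1` A `&` V @^-1` B) = P (U @^-1` A) * P (V @^-1` B)) ->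
  (forall w, (0 <= U w)%R) -> (forall w, (0 <= V w)%R) ->
  \int[P]_w (U w * V w)%:E = \int[P]_w (U w)%:E * \int[P]_w (V w)%:E.
Proof.
move=> UV U0 V0.
have absE (Z : {mfun Omega >-> R}) : (forall w, (0 <= Z w)%R) ->
    \int[P]_w (Z w)%:E = \int[distribution P Z]_x `|x|%:E.
  move=> Z0; rewrite ge0_integral_distribution//; last first.
    by apply/measurable_EFinP; exact: normr_measurable.
  by apply: eq_integral => w _ /=; rewrite ger0_norm.
rewrite !absE//.
(* The absolute values make [f] nonnegative on the whole plane, not only on the range of
   [(U, V)]. *)
pose f (z : R * R) := (`|z.1| * `|z.2|)%:E.
transitivity (\int[P]_w f (U w, V w)).
  by apply: eq_integral => w _ /=; rewrite /f /= !ger0_norm.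
rewrite (indep_ge0_integral UV (f := f)); last 2 first.
- apply/measurable_EFinP; apply: measurable_funM.
    by apply: measurableT_comp => //; exact: measurable_fst.
  by apply: measurableT_comp => //; exact: measurable_snd.
- by move=> z; rewrite lee_fin mulr_ge0.
have mabs : measurable_fun setT (fun y : R => `|y|%:E).
  by apply/measurable_EFinP; exact: normr_measurable.
rewrite -ge0_integralZr//; last by apply: integral_ge0 => y _; rewrite lee_fin.
apply: eq_integral => x _ /=.
by rewrite -ge0_integralZl.
Qed.


Local Close Scope ereal_scope.

Section rv_events.
Context {R : realType} {d0 : measure_display} {Omega : measurableType d0}.

Lemma rv_events_measurable (Z : Omega -> R) :
  measurable_fun setT Z -> rv_events Z `<=` measurable.
Proof. by move=> mZ _ [B mB <-]; rewrite -[_ @^-1` _]setTI; exact: mZ. Qed.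

Lemma rv_events_setI (Z : Omega -> R) : setI_closed (rv_events Z).
Proof.
by move=> _ _ [A mA <-] [B mB <-]; exists (A `&` B) => //; exact: measurableI.
Qed.

Lemma rv_eventsT (Z : Omega -> R) : rv_events Z setT.
Proof. by exists setT. Qed.

End rv_events.

Section independent_sequence.
Context {R : realType} {d0 : measure_display} {Omega : measurableType d0}.
Variables (P : probability Omega R) (Z : nat -> {RV P >-> R}).
Hypothesis indepZ : mutual_indep P (fun i => rv_events (Z i : Omega -> R)).

Let C i := rv_events (Z i : Omega -> R).

(** Equipping [Omega] with the sigma-algebra of a block turns dependence on the variables of that
    block alone into a measurability statement. *)
Lemma block_measurable_rv (s : seq nat) i : i \in s ->
  measurable_fun setT (Z i : g_sigma_algebraType (block_events C s) -> R).
Proof.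
move=> si _ B mB; rewrite setTI; apply: sub_sigma_algebra.
by apply: (@block_events1 _ _ _ C _ s i) => //; [move=> j; exact: rv_eventsT|exists B].
Qed.

Lemma block_indep_rv (s t : seq nat) (f g : Omega -> R) : uniq (s ++ t) ->
  measurable_fun setT (f : g_sigma_algebraType (block_events C s) -> R) ->
  measurable_fun setT (g : g_sigma_algebraType (block_events C t) -> R) ->
  forall A B : set R, measurable A -> measurable B ->
  P (f @^-1` A `&` g @^-1` B) = (P (f @^-1` A) * P (g @^-1` B))%E.
Proof.
move=> st mf mg A B mA mB.
suff [] : [/\ measurable (f @^-1` A), measurable (g @^-1` B) &
  P (f @^-1` A `&` g @^-1` B) = (P (f @^-1` A) * P (g @^-1` B))%E] by [].
apply: (block_events_indep indepZ) st _ _.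
- by move=> i; exact: rv_events_measurable.
- by move=> i; exact: rv_events_setI.
- by rewrite -[_ @^-1` _]setTI; exact: mf.
- by rewrite -[_ @^-1` _]setTI; exact: mg.
Qed.

(** The last factor is split off by induction: the product of the first [n] factors is measurable
    for the block of indices below [n], which is disjoint from [n]. *)
Lemma expectation_prod (g : nat -> R -> R) n :
  (forall i, measurable_fun setT (g i)) -> (forall i x, 0 <= g i x) ->
  (\int[P]_w (\prod_(i < n) g i (Z i w))%:E =
   \prod_(i < n) \int[P]_w (g i (Z i w))%:E)%E.
Proof.
move=> mg g0; elim: n => [|n IH].
  under eq_integral do rewrite big_ord0.
  by rewrite big_ord0 integral_cst// mul1e; exact: probability_setT.
rewrite big_ord_recr /= -IH.
pose f w := \prod_(i < n) g i (Z i w).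
(* Stated on an arbitrary space, since it serves both for [Omega] and for the sigma-algebra of a
   block. *)
have mprod d (T : measurableType d) (Y : nat -> T -> R) :
    (forall i, (i < n)%N -> measurable_fun setT (Y i)) ->
    measurable_fun setT (fun w => \prod_(i < n) g i (Y i w)).
  move=> mY; apply: measurable_prod => i _.
  by apply: measurableT_comp => //; exact: (mY i (ltn_ord i)).
have mf : measurable_fun setT f by exact: (mprod _ _ (fun i => Z i : Omega -> R)).
pose f' : {mfun Omega >-> R} := HB.pack f (isMeasurableFun.Build _ _ _ _ f mf).
have mh : measurable_fun setT (fun w => g n (Z n w)) by apply: measurableT_comp.
pose h' : {mfun Omega >-> R} := HB.pack (fun w => g n (Z n w))
  (isMeasurableFun.Build _ _ _ _ (fun w => g n (Z n w)) mh).
under eq_integral do rewrite big_ord_recr /=.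
apply: (@indep_ge0_expectationM _ _ _ P f' h').
- apply: (@block_indep_rv (iota 0 n) [:: n]).
  + by rewrite cats1 rcons_uniq iota_uniq mem_iota add0n ltnn.
  + apply: (@mprod _ (g_sigma_algebraType (block_events C (iota 0 n))) (fun i => Z i : _ -> R)).
    by move=> i ni; apply: block_measurable_rv; rewrite mem_iota.
  + apply: measurableT_comp => //; apply: block_measurable_rv.
    by rewrite inE.
- by move=> w; apply: prodr_ge0.
- by move=> w; exact: g0.
Qed.

End independent_sequence.

(* Garsia's maximal lemma: [excess y B N k] is the largest of the sums of [y i - B]
   over at most [N] consecutive indices starting from [k] (empty sum included). *)
Fixpoint excess {R : realType} (y : nat -> R) (B : R) (N k : nat) : R :=
  if N is N'.+1 then Num.max 0 (y k - B + excess y B N' k.+1) else 0.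

Section excess_sequence.
Context {R : realType} (y : nat -> R) (B : R).

Lemma excess_ge0 N k : 0 <= excess y B N k.
Proof. by case: N => [|N] //=; rewrite le_max lexx. Qed.

Lemma excess_ge_sum N k n : (n <= N)%N ->
  \sum_(k <= i < k + n) (y i - B) <= excess y B N k.
Proof.
elim: N k n => [|N IH] k [|n] nN //; first by rewrite addn0 big_geq.
  by rewrite addn0 big_geq// excess_ge0.
rewrite [leRHS]/= big_ltn ?addnS ?ltnS ?leq_addr// le_max lerD2l.
by apply/orP; right; have := IH k.+1 n nN; rewrite addSn.
Qed.

Lemma excessS_ge N k : excess y B N k <= excess y B N.+1 k.
Proof.
elim: N k => [|N IH] k; first by rewrite excess_ge0.
rewrite [leLHS]/= [leRHS]/=; apply: le_max2 => //.
by rewrite lerD2l; exact: IH.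
Qed.

(** Pathwise form of Garsia's argument: where the excess is positive, the maximum is a nonempty sum,
    which has paid [B] for its first term; elsewhere the left side is at most 0. *)
Lemma excess_gt0_le N k : 0 <= y k ->
  excess y B N.+1 k + B * (0 < excess y B N.+1 k)%R%:R <= y k + excess y B N k.+1.
Proof.
move=> yk; have [h|h] := ltP 0 (excess y B N.+1 k); last first.
  by rewrite mulr0 addr0 (le_trans h)// addr_ge0// excess_ge0.
move: h; rewrite /= lt_max ltxx/= => h; rewrite (max_r (ltW h)) mulr1.
by rewrite addrAC subrK.
Qed.

Lemma excess_le N k : 0 <= B -> 0 <= y k ->
  excess y B N.+1 k <= y k + excess y B N k.+1.
Proof.
move=> B0 yk; apply: le_trans (excess_gt0_le _ yk).
by rewrite lerDl mulr_ge0.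
Qed.

End excess_sequence.

Lemma measurable_excess {R : realType} d (T : measurableType d) (Y : nat -> T -> R)
    B N k :
  (forall i, (k <= i < k + N)%N -> measurable_fun setT (Y i)) ->
  measurable_fun setT (fun w => excess (Y^~ w) B N k).
Proof.
elim: N k => [|N IH] k mY; first exact: measurable_cst.
apply: measurable_maxr; first exact: measurable_cst.
apply: measurable_funD; first apply: measurable_funB.
- by apply: mY; rewrite leqnn addnS ltnS leq_addr.
- exact: measurable_cst.
apply: IH => i /andP[ki ik]; apply: mY; rewrite (ltnW ki)/=.
by rewrite addnS -addSn.
Qed.

(** * A maximal inequality for the sums of squares of an i.i.d. sequence *)

Section maximal_inequality.
Context {R : realType} {d0 : measure_display} {Omega : measurableType d0}.
Variables (P : probability Omega R) (Z : nat -> {RV P >-> R}).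
Hypothesis indepZ : mutual_indep P (fun i => rv_events (Z i : Omega -> R)).
Hypothesis idZ : forall i (A : set R), measurable A ->
  P ((Z i : Omega -> R) @^-1` A) = P ((Z 0%N : Omega -> R) @^-1` A).
Variables (B s2 : R).
Hypothesis B0 : 0 < B.
Hypothesis Z2 : (\int[P]_w ((Z 0%N w) ^+ 2)%:E = s2%:E)%E.

Let C i := rv_events (Z i : Omega -> R).
Let L N k w := excess (fun i => Z i w ^+ 2) B N k.

Let mL N k : measurable_fun setT (L N k).
Proof.
apply: (@measurable_excess _ _ _ (fun i w => Z i w ^+ 2)) => i _.
exact: measurable_funX.
Qed.
HB.instance Definition _ N k := isMeasurableFun.Build _ _ _ _ (L N k) (mL N k).

Let indep_head N k (A D : set R) : measurable A -> measurable D ->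
  P (Z k @^-1` A `&` L N k.+1 @^-1` D) = (P (Z k @^-1` A) * P (L N k.+1 @^-1` D))%E.
Proof.
apply: (block_indep_rv indepZ (s := [:: k]) (t := iota k.+1 N)).
- by rewrite /= iota_uniq mem_iota ltnn.
- by apply: block_measurable_rv; rewrite inE.
- apply: (@measurable_excess _ _ (g_sigma_algebraType (block_events C (iota k.+1 N)))
    (fun i w => Z i w ^+ 2)) => i ik.
  by apply: measurable_funX; apply: block_measurable_rv; rewrite mem_iota.
Qed.

Lemma integral_id_distribution k (f : R -> \bar R) :
  (\int[distribution P (Z k)]_x f x = \int[distribution P (Z 0%N)]_x f x)%E.
Proof. by apply: eq_measure_integral => A mA _; exact: idZ. Qed.

(** Stationarity, by induction on [N]: the excess from [k] is a function [f] of [Z k] and of the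
    excess from [k + 1], which are independent with laws that do not depend on [k]. *)
Let excess_law N k (A : set R) : measurable A ->
  P (L N k @^-1` A) = P (L N 0%N @^-1` A).
Proof.
elim: N k A => [//|N IH] k A mA.
pose f (z : R * R) : R := Num.max 0 (z.1 ^+ 2 - B + z.2).
have mf : measurable_fun setT f.
  apply: measurable_maxr => //; apply: measurable_funD; last exact: measurable_snd.
  apply: measurable_funB => //; apply: measurable_funX; exact: measurable_fst.
have mfA : measurable (f @^-1` A) by rewrite -[X in measurable X]setTI; exact: mf.
have lawE j : P (L N.+1 j @^-1` A) = (\int[distribution P (Z 0%N)]_x
    \int[distribution P (L N 0%N)]_y (\1_(f @^-1` A) (x, y))%:E)%E.
  transitivity (\int[P]_w (\1_(f @^-1` A) (Z j w, L N j.+1 w))%:E)%E.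
    have -> : (fun w => (\1_(f @^-1` A) (Z j w, L N j.+1 w))%:E) =
              (fun w => (\1_(L N.+1 j @^-1` A) w)%:E) :> (Omega -> \bar R).
      by apply/funext => w; rewrite !indicE; congr ((_ _)%:R%:E); apply/idP/idP;
        rewrite !inE.
    rewrite integral_indic ?setIT//.
    by rewrite -[X in measurable X]setTI; exact: mL.
  rewrite (@indep_ge0_integral _ _ _ _ _ _ _ P (Z j) (L N j.+1) (@indep_head N j)
    (fun z => (\1_(f @^-1` A) z)%:E)); last 2 first.
  - by apply/measurable_EFinP; exact: measurable_indic.
  - by move=> z; rewrite lee_fin.
  rewrite integral_id_distribution; apply: eq_integral => x _.
  by apply: eq_measure_integral => D mD _; exact: IH.
by rewrite !lawE.
Qed.

Let expectation_excess N k :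
  (\int[P]_w (L N k w)%:E = \int[P]_w (L N 0%N w)%:E)%E.
Proof.
have absE j : (\int[P]_w (L N j w)%:E = \int[distribution P (L N j)]_x `|x|%:E)%E.
  rewrite ge0_integral_distribution//; last first.
    by apply/measurable_EFinP; exact: normr_measurable.
  by apply: eq_integral => w _ /=; rewrite ger0_norm// excess_ge0.
rewrite !absE; apply: eq_measure_integral => D mD _; exact: excess_law.
Qed.

Let mL' N k : measurable_fun setT (fun w => (L N k w)%:E).
Proof. exact/measurable_EFinP/mL. Qed.

Let mZ2 k : measurable_fun setT (fun w => ((Z k w) ^+ 2)%:E).
Proof. by apply/measurable_EFinP; exact: measurable_funX. Qed.

(** Finiteness allows expected excesses to be subtracted from each other. *)
Let expectation_excess_fin N : exists e : R, (\int[P]_w (L N 0%N w)%:E = e%:E)%E.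
Proof.
suff : (\int[P]_w (L N 0%N w)%:E < +oo)%E.
  rewrite -ge0_fin_numE; last first.
    by apply: integral_ge0 => w _; rewrite lee_fin excess_ge0.
  by move=> h; exists (fine (\int[P]_w (L N 0%N w)%:E)); rewrite fineK.
elim: N => [|N IH]; first by rewrite /L /= integral0.
apply: (@le_lt_trans _ _ (\int[P]_w (((Z 0%N w) ^+ 2)%:E + (L N 1%N w)%:E))%E).
  apply: ge0_le_integral => //.
  - by move=> w _; rewrite lee_fin excess_ge0.
  - exact: emeasurable_funD.
  - move=> w _; rewrite -EFinD lee_fin; apply: excess_le; first exact: ltW.
    exact: sqr_ge0.
rewrite ge0_integralD//.
- by rewrite Z2 expectation_excess lte_add_pinfty// ltry.
- by move=> w _; rewrite lee_fin sqr_ge0.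
- by move=> w _; rewrite lee_fin excess_ge0.
Qed.

(** Taking expectations in the pathwise inequality and using stationarity, [B] times the probability
    is at most [s2] plus the expected excess over one index fewer minus the expected excess itself;
    this difference is at most 0, as the excess grows with [N]. *)
Lemma prob_excess_gt0 N : (P [set w | 0 < L N 0%N w]%R <= (s2 / B)%:E)%E.
Proof.
have mS M : measurable [set w | 0 < L M 0%N w].
  rewrite (_ : [set w | _] = L M 0%N @^-1` `]0, +oo[%classic).
    by rewrite -[X in measurable X]setTI; exact: mL.
  by apply/seteqP; split => w /=; rewrite in_itv/= andbT.
have s20 : 0 <= s2.
  by rewrite -lee_fin -Z2 integral_ge0// => w _; rewrite lee_fin sqr_ge0.
case: N => [|N].
  rewrite (_ : [set w | _] = set0); first by rewrite measure0 lee_fin divr_ge0// ltW.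
  by apply/seteqP; split => w //=; rewrite /L /= ltxx.
have [e0 e0E] := expectation_excess_fin N.
have [e1 e1E] := expectation_excess_fin N.+1.
have e01 : e0 <= e1.
  rewrite -lee_fin -e0E -e1E; apply: ge0_le_integral => //.
  - by move=> w _; rewrite lee_fin excess_ge0.
  - by move=> w _; rewrite lee_fin; exact: excessS_ge.
have [p pE] := probability_real P (mS N.+1).
have : (\int[P]_w ((L N.+1 0%N w)%:E + B%:E * (\1_[set w | 0 < L N.+1 0%N w]%R w)%:E)
        <= \int[P]_w (((Z 0%N w) ^+ 2)%:E + (L N 1%N w)%:E))%E.
  apply: ge0_le_integral => //.
  - move=> w _; rewrite -EFinM -EFinD lee_fin addr_ge0 ?excess_ge0//.
    by rewrite mulr_ge0// ltW.
  - apply: emeasurable_funD => //; apply: measurable_funeM.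
    by apply/measurable_EFinP; exact: measurable_indic.
  - exact: emeasurable_funD.
  - move=> w _; rewrite -EFinM -!EFinD lee_fin.
    rewrite (_ : \1__ w = (0 < L N.+1 0%N w)%R%:R); first exact/excess_gt0_le/sqr_ge0.
    by rewrite indicE; congr (_ _)%:R; apply/idP/idP; rewrite inE.
have mB : measurable_fun setT (fun w => B%:E * (\1_[set w | 0 < L N.+1 0%N w]%R w)%:E)%E.
  by apply: measurable_funeM; apply/measurable_EFinP; exact: measurable_indic.
have L0 M k w : setT w -> (0 <= (L M k w)%:E)%E by rewrite lee_fin excess_ge0.
have Z0 w : setT w -> (0 <= (Z 0%N w ^+ 2)%:E)%E by rewrite lee_fin sqr_ge0.
have B1 w : setT w -> (0 <= B%:E * (\1_[set w | 0 < L N.+1 0%N w]%R w)%:E)%E.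
  by rewrite -EFinM lee_fin mulr_ge0// ltW.
rewrite !ge0_integralD//; try exact: L0; try exact: Z0; try exact: B1.
rewrite ge0_integralZl//; last 2 first.
- by apply/measurable_EFinP; exact: measurable_indic.
- by rewrite lee_fin ltW.
rewrite integral_indic// setIT => h.
have {h} : (e1%:E + B%:E * p%:E <= s2%:E + e0%:E)%E.
  by rewrite -pE -e1E -e0E -Z2 -(expectation_excess N 1).
rewrite pE -EFinM -!EFinD !lee_fin => h.
by rewrite ler_pdivlMr//; lra.
Qed.

(** The events of positive excess increase with [N], so their union inherits the bound; outside it
    no partial sum exceeds its threshold. *)
Lemma prob_sum_sqr_gt :
  exists A : set Omega, [/\ measurable A, (P A <= (s2 / B)%:E)%E &
    forall w, ~ A w -> forall n, \sum_(i < n) Z i w ^+ 2 <= B * n%:R].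
Proof.
pose S N := [set w | 0 < L N 0%N w].
have mS N : measurable (S N).
  rewrite (_ : S N = L N 0%N @^-1` `]0, +oo[%classic).
    by rewrite -[X in measurable X]setTI; exact: mL.
  by apply/seteqP; split => w /=; rewrite in_itv/= andbT.
exists (\bigcup_N S N); split; first exact: bigcupT_measurable.
- have ndS : nondecreasing_seq S.
    apply/nondecreasing_seqP => N; apply/subsetPset => w /= h.
    exact: lt_le_trans h (excessS_ge _ _ _ _).
  have cS : P \o S @ \oo --> P (\bigcup_N S N).
    by apply: nondecreasing_cvg_mu => //; exact: bigcupT_measurable.
  rewrite -(cvg_lim _ cS)//; apply: lime_le; first by apply/cvg_ex; eexists; exact: cS.
  by apply: nearW => N; exact: prob_excess_gt0.
- move=> w nA n; rewrite leNgt; apply/negP => h; apply: nA; exists n => //.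
  apply: lt_le_trans (excess_ge_sum _ _ _ (leqnn n)).
  by rewrite add0n sumrB sumr_const_nat subn0 big_mkord -mulr_natr subr_gt0.
Qed.

End maximal_inequality.

(** * Finiteness of the second moment from the tail condition *)

(** A discrete layer-cake bound: the layers telescope, since [(k + 1)^2 - k^2 = 2 k + 1]. *)
Lemma sqr_le_layers {R : realType} (x : R) N : 0 <= x -> x <= N%:R ->
  x ^+ 2 <= \sum_(0 <= k < N) (2 * k + 1)%:R * (k%:R < x)%R%:R.
Proof.
(* Writing [x] as its minimum with [N] frees the induction on [N] from the bound on [x]. *)
move=> x0 xN; rewrite -[X in X ^+ 2](min_l xN).
elim: N {xN} => [|N IH]; first by rewrite (min_r x0) big_geq// expr0n.
rewrite big_nat_recr//=; have [xN|xN] := leP x N%:R.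
  rewrite mulr0 addr0 (min_l (le_trans xN _)) ?ler_nat//.
  by rewrite (min_l xN) in IH.
rewrite (min_r (ltW xN)) in IH; rewrite mulr1.
apply: (@le_trans _ _ (N.+1%:R ^+ 2)).
  by rewrite lerXn2r// ?nnegrE// ?le_min ?x0 ?ler0n// ge_min lexx orbT.
rewrite (_ : N.+1%:R ^+ 2 = N%:R ^+ 2 + (2 * N + 1)%:R :> R); first by rewrite lerD2r.
by rewrite -!natrX -natrD; congr _%:R; lia.
Qed.

Section second_moment.
Context {R : realType} {d0 : measure_display} {Omega : measurableType d0}.
Variables (P : probability Omega R) (Z : {RV P >-> R}) (p : R).
Hypothesis p2 : 2 <= p.
Hypothesis htail : (\int[lebesgue_measure]_(t in `[0%R, +oo[%classic)
  ((fine (P [set w | t < `|(Z : Omega -> R) w|])) `^ p^-1)%:E < +oo)%E.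

Let q (t : R) := fine (P [set w | t < `|(Z : Omega -> R) w|]).
Let a (t : R) := q t `^ p^-1.

Let mS (t : R) : measurable [set w | t < `|(Z : Omega -> R) w|].
Proof.
rewrite (_ : [set w | _] = (fun w => `|Z w|) @^-1` `]t, +oo[%classic).
  have mN : measurable_fun setT (fun w => `|Z w|) by exact: measurableT_comp.
  by rewrite -[X in measurable X]setTI; exact: mN.
by apply/seteqP; split => w /=; rewrite in_itv/= andbT.
Qed.

Let qE t : P [set w | t < `|(Z : Omega -> R) w|] = (q t)%:E.
Proof. by rewrite fineK// fin_num_measure. Qed.

Let q0 t : 0 <= q t. Proof. by rewrite fine_ge0. Qed.
Let q1 t : q t <= 1. Proof. by rewrite -lee_fin -qE probability_le1. Qed.

Let q_ni s t : s <= t -> q t <= q s.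
Proof.
move=> st; rewrite -lee_fin -!qE le_measure ?inE//.
by move=> w /=; exact: le_lt_trans.
Qed.

Let p0 : 0 < p. Proof. by rewrite (lt_le_trans _ p2). Qed.

Let a_ni s t : s <= t -> a t <= a s.
Proof.
move=> st; apply: ge0_ler_powR; rewrite ?nnegrE ?q_ni//.
by rewrite invr_ge0 ltW.
Qed.

Let a0 t : 0 <= a t. Proof. exact: powR_ge0. Qed.

(** As [q t <= 1] and [2 / p <= 1], raising [q t] to the power [2 / p] does not decrease it. *)
Let q_le_sqr t : q t <= a t ^+ 2.
Proof.
rewrite -powR_mulrn// /a -powRrM.
set e := p^-1 * 2%:R.
have {1}-> : q t = q t `^ e * q t `^ (1 - e).
  by rewrite -powRD addrC subrK ?powRr1// oner_eq0.
rewrite ler_piMr ?powR_ge0// -[leRHS](congr1 (@^~ (1 - e)) (@powR1 R)).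
apply: ge0_ler_powR; rewrite ?nnegrE ?q1//.
by rewrite subr_ge0 /e mulrC ler_pdivrMr// mul1r.
Qed.

Let I := fine (\int[lebesgue_measure]_(t in `[0%R, +oo[%classic) (a t)%:E)%E.

Let IE : (\int[lebesgue_measure]_(t in `[0%R, +oo[%classic) (a t)%:E = I%:E)%E.
Proof.
rewrite fineK// ge0_fin_numE//; apply: integral_ge0 => t _.
by rewrite lee_fin.
Qed.

Let ma : measurable_fun (`[0%R, +oo[%classic : set R) a.
Proof. by apply: nonincreasing_measurable => // s t _ _; exact: a_ni. Qed.

(** Integral comparison: [a] is nonincreasing, so the step function equal to [a (k + 1)] on []k, k +
    1]] lies below it. *)
Let sum_tail N : \sum_(0 <= k < N) a k.+1%:R <= I.
Proof.
pose g N (t : R) := \sum_(0 <= k < N) a k.+1%:R * \1_(`]k%:R, k.+1%:R]%classic : set R) t.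
have gN M t : g M t <= (if t <= M%:R then a t else 0).
  elim: M => [|M IH]; first by rewrite /g big_geq//; case: ifP.
  rewrite /g big_nat_recr//= -/(g M t) indicE.
  have [tM|tM] := leP t M%:R.
    rewrite (le_trans tM) ?ler_nat// memNset ?mulr0 ?addr0 => [|/=].
      by rewrite tM in IH.
    by rewrite in_itv/= ltNge tM.
  rewrite (lt_geF tM) in IH.
  have [tM1|tM1] := leP t M.+1%:R.
    rewrite mem_set/= ?in_itv/= ?tM//.
    by rewrite mulr1 -[leRHS]add0r lerD// a_ni.
  rewrite memNset/= ?in_itv/= ?mulr0 ?addr0//.
  by rewrite [X in _ && X]leNgt tM1 andbF.
rewrite -lee_fin -IE.
apply: (@le_trans _ _ (\int[lebesgue_measure]_(t in `[0%R, +oo[%classic) (g N t)%:E)%E).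
  rewrite /g; under eq_integral do rewrite -sumEFin.
  rewrite ge0_integral_sum//; last 2 first.
  - move=> k; apply/measurable_EFinP/measurable_funM => //.
  - by move=> k t _; rewrite lee_fin mulr_ge0.
  rewrite -sumEFin lee_sum// => k _.
  under eq_integral do rewrite EFinM.
  rewrite ge0_integralZl//; last 2 first.
  - by apply/measurable_EFinP; exact: measurable_indic.
  - by rewrite lee_fin.
  rewrite integral_indic//.
  rewrite (_ : `]k%:R, k.+1%:R]%classic `&` _ = `]k%:R, k.+1%:R]%classic).
    have lm : lebesgue_measure (`]k%:R, k.+1%:R]%classic : set R) = 1%E.
      by rewrite lebesgue_measure_itv/= lte_fin ltr_nat ltnSn -EFinB -natrB// subSnn.
    by rewrite [X in (_ * X)%E]lm mule1.
  apply/setIidPl => t /=; rewrite !in_itv/= andbT => /andP[kt _].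
  by rewrite (le_trans _ (ltW kt)).
apply: ge0_le_integral => //.
- move=> t _; rewrite lee_fin sumr_ge0// => k _; exact: mulr_ge0.
- apply/measurable_EFinP; apply: measurable_sum => k.
  by apply: measurable_funM => //; exact: measurable_indic.
- exact/measurable_EFinP.
- move=> t _; rewrite lee_fin (le_trans (gN N t))//.
  by case: ifP.
Qed.

(** The first [k] terms of the preceding sum are all at least [a k]. *)
Let nat_tail k : k%:R * a k%:R <= I.
Proof.
apply: le_trans (sum_tail k).
rewrite mulr_natl -[X in a k%:R *+ X]subn0 -sumr_const_nat.
rewrite ler_sum_nat// => i /andP[_ ik].
by apply: a_ni; rewrite ler_nat.
Qed.

Let I0 : 0 <= I. Proof. by apply: le_trans (sum_tail 0); rewrite big_geq. Qed.

Lemma second_moment_fin : exists s2 : R, (\int[P]_w (Z w ^+ 2)%:E = s2%:E)%E.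
Proof.
(* The layer [k = 0] contributes at most 1. For [k >= 1], [(2 k + 1) q k <= 3 k (a k)^2 <= 3 I a k],
   and these [a k] sum to at most [I]. *)
suff h : (\int[P]_w (Z w ^+ 2)%:E <= (1 + 3 * I * I)%:E)%E.
  exists (fine (\int[P]_w (Z w ^+ 2)%:E)); rewrite fineK// ge0_fin_numE.
    by rewrite (le_lt_trans h)// ltry.
  by apply: integral_ge0 => w _; rewrite lee_fin sqr_ge0.
pose f k w := ((2 * k + 1)%:R * \1_[set w | k%:R < `|Z w|] w)%:E : \bar R.
have f0 k w : (0 <= f k w)%E by rewrite lee_fin mulr_ge0.
have mf k : measurable_fun setT (f k).
  by apply/measurable_EFinP; apply: measurable_funM => //.
apply: (@le_trans _ _ (\int[P]_w (\sum_(0 <= k <oo) f k w))%E).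
  apply: ge0_le_integral => //.
  - by move=> w _; rewrite lee_fin sqr_ge0.
  - by apply/measurable_EFinP; exact: measurable_funX.
  - exact: ge0_emeasurable_sum.
  move=> w _; have [N wN] : exists N : nat, `|Z w| <= N%:R.
    by exists (Num.truncn `|Z w|).+1; rewrite ltW// truncnS_gt.
  apply: le_trans (nneseries_lim_ge N _) => //.
  rewrite sumEFin lee_fin -real_normK ?num_real//.
  apply: le_trans (sqr_le_layers _ wN) _ => //.
  rewrite le_eqVlt; apply/orP; left; apply/eqP/eq_bigr => k _.
  rewrite indicE; congr (_ * (_ _)%:R).
  by apply/idP/idP; rewrite inE.
rewrite integral_nneseries//.
have fE k : (\int[P]_w f k w = ((2 * k + 1)%:R * q k%:R)%:E)%E.
  rewrite /f; under eq_integral do rewrite EFinM.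
  rewrite ge0_integralZl//.
    by rewrite integral_indic ?setIT// EFinM -qE.
  by apply/measurable_EFinP; apply: measurable_indic.
apply: lime_le; first by apply: is_cvg_nneseries => k _ _; exact: integral_ge0.
apply: nearW => N; under eq_bigr do rewrite fE.
rewrite sumEFin lee_fin.
case: N => [|N]; first by rewrite big_geq// addr_ge0 ?mulr_ge0.
rewrite big_nat_recl//= lerD//; first by rewrite mul1r.
apply: (@le_trans _ _ (\sum_(0 <= k < N) 3 * I * a k.+1%:R)); last first.
  by rewrite -mulr_sumr ler_wpM2l// mulr_ge0.
apply: ler_sum => k _.
apply: (@le_trans _ _ (3 * k.+1%:R * a k.+1%:R ^+ 2)).
  apply: ler_pM => //.
  by rewrite -natrM ler_nat; lia.
have := nat_tail k.+1; have := a0 k.+1%:R => h0 h1.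
rewrite expr2 !mulrA -(mulrA 3) ler_wpM2r//.
by rewrite ler_wpM2l.
Qed.

End second_moment.

(** * Self-normalized exponential inequality, and rational half-spaces *)

(** With [u = x^2 - x > -1], [exp(- u) <= 1 / (1 + u)], and [(1 + x + x^2) (1 - x + x^2) = 1 + x^2 +
    x^4 >= 1]. *)
Lemma expR_sub_sqr_le {R : realType} (x : R) : expR (x - x ^+ 2) <= 1 + x + x ^+ 2.
Proof.
have h : 0 < 1 + (x ^+ 2 - x).
  have := sqr_ge0 (x - 2^-1); rewrite sqrrB => h.
  nra.
rewrite -opprB expRN; apply: (@le_trans _ _ (1 + (x ^+ 2 - x))^-1).
  by rewrite lef_pV2 ?posrE ?expR_gt0// expR_ge1Dx.
rewrite -div1r ler_pdivrMr//; have := sqr_ge0 x; have := sqr_ge0 (x ^+ 2).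
rewrite !expr2; nra.
Qed.

(** Finitely many points leave a gap: the negative values are below [- 2 m]. Shifting the affine
    function up by [m] and approximating it within [m] by rational coefficients therefore gives the
    same trace. *)
Lemma halfspace_rat {R : realType} (n d : nat) (x : 'I_n -> 'I_d -> R)
    (g : 'I_d -> R) (b : R) :
  exists (g' : {ffun 'I_d -> rat}) (b' : rat), forall i,
    (0 <= \sum_j g j * x i j + b) = (0 < \sum_j ratr (g' j) * x i j + ratr b').
Proof.
pose u i := \sum_j g j * x i j + b.
(* The inverse of [S] is below the absolute value of every negative [u i]; the summand 1 keeps [S]
   positive when there is none. *)
pose S := 1 + \sum_i (if u i < 0 then `|u i|^-1 else 0).
have S0 : 0 < S.
  by rewrite ltr_pwDl// sumr_ge0// => i _; case: ifP => // _; rewrite invr_ge0.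
pose m := S^-1 / 3.
have m0 : 0 < m by rewrite divr_gt0 ?invr_gt0.
have um i : u i < 0 -> u i < - 2 * m.
  move=> ui; have : `|u i|^-1 < S.
    rewrite /S (bigD1 i)//= ui ltr_pwDl// lerDl.
    by rewrite sumr_ge0// => j _; case: ifP => // _; rewrite invr_ge0.
  rewrite -ltf_pV2 ?posrE ?invr_gt0 ?normr_gt0 ?lt_eqF// invrK ltr0_norm// => h.
  have : 3 * m = S^-1 by rewrite /m mulrC divfK.
  lra.
pose K := 1 + \sum_i \sum_j `|x i j|.
have K0 : 0 < K by rewrite ltr_pwDl// sumr_ge0// => i _; rewrite sumr_ge0.
have K1 i : \sum_j `|x i j| <= K.
  rewrite /K (bigD1 i)//= addrCA lerDl addr_ge0// sumr_ge0// => k _.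
  by rewrite sumr_ge0.
(* The coefficients then contribute an error of at most [h K = m / 2], and the intercept less than
   [m / 4]. *)
pose h := m / (2 * K).
have h0 : 0 < h by rewrite divr_gt0// mulr_gt0.
have ratnear (y e : R) : 0 < e -> exists q : rat, `|ratr q - y| < e.
  move=> e0; have /rat_in_itvoo[q] : y - e < y + e by lra.
  by rewrite in_itv/= => /andP[q1 q2]; exists q; rewrite ltr_norml; lra.
have /choice[g' g'P] j : exists q : rat, `|ratr q - g j| < h by exact: ratnear.
have [b' b'P] : exists q : rat, `|ratr q - (b + m)| < m / 4.
  by apply: ratnear; rewrite divr_gt0.
exists (finfun g'), b' => i.
set v := \sum_j _ + ratr b'.
have : `|v - (u i + m)| < m.
  have -> : v - (u i + m) =
      \sum_j (ratr (g' j) - g j) * x i j + (ratr b' - (b + m)).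
    rewrite /v /u; under eq_bigr do rewrite ffunE.
    under [in RHS]eq_bigr do rewrite mulrBl.
    by rewrite sumrB; ring.
  apply: le_lt_trans (ler_normD _ _) _.
  have : `|\sum_j (ratr (g' j) - g j) * x i j| <= m / 2.
    apply: le_trans (ler_norm_sum _ _ _) _.
    apply: (@le_trans _ _ (\sum_j h * `|x i j|)).
      by apply: ler_sum => j _; rewrite normrM ler_wpM2r// ltW.
    rewrite -mulr_sumr (_ : m / 2 = h * K); first by rewrite ler_wpM2l// ltW.
    by rewrite /h; field; rewrite gt_eqF.
  lra.
rewrite -/(u i) ltr_norml => /andP[v1 v2].
have [ui|ui] := leP 0 (u i); apply/esym; first by lra.
by apply/negbTE; rewrite -leNgt; have := um i ui; lra.
Qed.

Section exponential_inequality.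
Context {R : realType} {d0 : measure_display} {Omega : measurableType d0}.
Variables (P : probability Omega R) (Z : nat -> {RV P >-> R}).
Hypothesis indepZ : mutual_indep P (fun i => rv_events (Z i : Omega -> R)).
Hypothesis idZ : forall i (A : set R), measurable A ->
  P ((Z i : Omega -> R) @^-1` A) = P ((Z 0%N : Omega -> R) @^-1` A).
Variable s2 : R.
Hypothesis Z1 : ('E_P[Z 0%N] = 0)%E.
Hypothesis Z2 : (\int[P]_w ((Z 0%N w) ^+ 2)%:E = s2%:E)%E.

Lemma integrable_sqr : P.-integrable setT (fun w => (Z 0%N w ^+ 2)%:E).
Proof.
apply/integrableP; split; first by apply/measurable_EFinP; exact: measurable_funX.
under eq_integral do rewrite gee0_abs ?lee_fin ?sqr_ge0//.
by rewrite Z2 ltry.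
Qed.

Lemma integrable_of_sqr : P.-integrable setT (fun w => (Z 0%N w)%:E).
Proof.
have int1 : P.-integrable setT (fun w => (1 + Z 0%N w ^+ 2)%:E).
  apply: (eq_integrable _ (cst 1 \+ (fun w => (Z 0%N w ^+ 2)%:E))%E) => //.
  apply: integrableD => //; last exact: integrable_sqr.
  exact: finite_measure_integrable_cst.
apply: le_integrable int1 => //; first exact/measurable_EFinP.
move=> w _; rewrite lee_fin [leRHS]ger0_norm ?addr_ge0 ?sqr_ge0//.
rewrite -real_normK ?num_real//; have := sqr_ge0 (`|Z 0%N w| - 1); rewrite sqrrB1 => h.
have := normr_ge0 (Z 0%N w); lra.
Qed.

(** As [s ^+ 2 <= 1], the integrand is at most [1 + x + lam^2 Z^2] with [x = lam s Z]. The linear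
    term has mean 0, which leaves [1 + lam^2 s2]. *)
Lemma expectation_expR_le (lam s : R) i : s ^+ 2 <= 1 ->
  (\int[P]_w (expR (lam * s * Z i w - lam ^+ 2 * Z i w ^+ 2))%:E
   <= (expR (lam ^+ 2 * s2))%:E)%E.
Proof.
move=> s1.
pose f (x : R) := expR (lam * s * x - lam ^+ 2 * x ^+ 2).
have mf : measurable_fun setT f.
  apply: measurableT_comp => //; apply: measurable_funB.
    exact: measurable_funM.
  by apply: measurable_funM => //; exact: measurable_funX.
have mfE : measurable_fun setT (fun x => (f x)%:E) by exact/measurable_EFinP.
have -> : (\int[P]_w (f (Z i w))%:E = \int[P]_w (f (Z 0%N w))%:E)%E.
  have fE j : (\int[P]_w (f (Z j w))%:E = \int[distribution P (Z j)]_x (f x)%:E)%E.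
    by rewrite ge0_integral_distribution// => x; rewrite lee_fin expR_ge0.
  by rewrite !fE (integral_id_distribution idZ).
apply: (@le_trans _ _ (\int[P]_w ((1 + lam * s * Z 0%N w)%:E
    + (lam ^+ 2 * Z 0%N w ^+ 2)%:E))%E).
  apply: ge0_le_integral => //.
  - by move=> w _; rewrite lee_fin expR_ge0.
  - by apply/measurable_EFinP; apply: measurableT_comp.
  - apply: emeasurable_funD; apply/measurable_EFinP.
      by apply: measurable_funD => //; exact: measurable_funM.
    by apply: measurable_funM => //; exact: measurable_funX.
  move=> w _; rewrite -EFinD lee_fin.
  have hx : (lam * s * Z 0%N w) ^+ 2 <= lam ^+ 2 * Z 0%N w ^+ 2.
    rewrite !exprMn -mulrA ler_wpM2l ?sqr_ge0// ler_piMl ?sqr_ge0//.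
  apply: le_trans (le_trans (expR_sub_sqr_le (lam * s * Z 0%N w)) _).
    by rewrite ler_expR lerB.
  by rewrite lerD2l.
have i1 : P.-integrable setT (fun w => (1 + lam * s * Z 0%N w)%:E).
  apply: (eq_integrable _ (cst 1 \+ (fun w => (lam * s)%:E * (Z 0%N w)%:E))%E) => //.
  apply: integrableD => //; first exact: finite_measure_integrable_cst.
  apply: integrableZl => //; exact: integrable_of_sqr.
have i2 : P.-integrable setT (fun w => (lam ^+ 2 * Z 0%N w ^+ 2)%:E).
  apply: (eq_integrable _ (fun w => (lam ^+ 2)%:E * (Z 0%N w ^+ 2)%:E)%E) => //.
  apply: integrableZl => //; exact: integrable_sqr.
rewrite integralD//.
have -> : (\int[P]_w (1 + lam * s * Z 0%N w)%:E = 1)%E.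
  under eq_integral do rewrite EFinD EFinM.
  rewrite integralD//; last 2 first.
  - exact: finite_measure_integrable_cst.
  - apply: integrableZl => //; exact: integrable_of_sqr.
  rewrite integral_cst// mul1e integralZl//; last exact: integrable_of_sqr.
  move: Z1; rewrite unlock => ->; rewrite mule0 adde0; exact: probability_setT.
have -> : (\int[P]_w (lam ^+ 2 * Z 0%N w ^+ 2)%:E = (lam ^+ 2 * s2)%:E)%E.
  under eq_integral do rewrite EFinM.
  by rewrite integralZl// ?Z2//; exact: integrable_sqr.
by rewrite -EFinD lee_fin expR_ge1Dx.
Qed.

(* Chernoff's bound, self-normalized so that two moments suffice. *)
Lemma prob_self_normalized_sum (lam t : R) (s : nat -> R) n :
  (forall i, s i ^+ 2 <= 1) ->
  (P [set w | (n%:R * (lam ^+ 2 * s2) + t <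
     lam * \sum_(i < n) s i * Z i w - lam ^+ 2 * \sum_(i < n) Z i w ^+ 2)%R]
   <= (expR (- t))%:E)%E.
Proof.
move=> s1; set S := [set w | _].
pose g i (x : R) := expR (lam * s i * x - lam ^+ 2 * x ^+ 2).
have mg i : measurable_fun setT (g i).
  apply: measurableT_comp => //; apply: measurable_funB.
    exact: measurable_funM.
  by apply: measurable_funM => //; exact: measurable_funX.
have gE w : \prod_(i < n) g i (Z i w) =
    expR (lam * \sum_(i < n) s i * Z i w - lam ^+ 2 * \sum_(i < n) Z i w ^+ 2).
  rewrite !mulr_sumr -sumrB expR_sum; apply: eq_bigr => i _.
  by rewrite /g mulrA.
have mG : measurable_fun setT (fun w => \prod_(i < n) g i (Z i w)).
  by apply: measurable_prod => i _; exact: measurableT_comp.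
have mS : measurable S.
  rewrite (_ : S = (fun w => \prod_(i < n) g i (Z i w)) @^-1`
      `]expR (n%:R * (lam ^+ 2 * s2) + t), +oo[%classic).
    by rewrite -[X in measurable X]setTI; exact: mG.
  by apply/seteqP; split => w /=; rewrite /S/= in_itv/= andbT gE ltr_expR.
set c := n%:R * (lam ^+ 2 * s2) + t.
(* Markov's inequality for the exponential; independence then factors the expectation. *)
have : ((expR c)%:E * P S <= (expR (n%:R * (lam ^+ 2 * s2)))%:E)%E.
  apply: (@le_trans _ _ (\int[P]_w (\prod_(i < n) g i (Z i w))%:E)%E).
    have -> : ((expR c)%:E * P S = \int[P]_w ((expR c)%:E * (\1_S w)%:E))%E.
      rewrite ge0_integralZl// ?integral_indic ?setIT// ?lee_fin ?expR_ge0//.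
      by apply/measurable_EFinP; exact: measurable_indic.
    apply: ge0_le_integral => //.
    - by apply: measurable_funeM; apply/measurable_EFinP; exact: measurable_indic.
    - exact/measurable_EFinP.
    move=> w _; rewrite -EFinM lee_fin gE indicE.
    have [/set_mem wS|wS] := boolP (w \in S); last by rewrite mulr0 expR_ge0.
    by rewrite mulr1 ler_expR ltW.
  rewrite (expectation_prod indepZ)//; last by move=> i x; exact: expR_ge0.
  rewrite expRM_natl; elim: (n) => [|m IH]; first by rewrite big_ord0 expr0.
  rewrite big_ord_recr exprSr EFinM lee_pmul//.
  - by apply: prode_ge0 => i _; apply: integral_ge0 => w _; rewrite lee_fin expR_ge0.
  - by apply: integral_ge0 => w _; rewrite lee_fin expR_ge0.
  - exact: expectation_expR_le.
have [p ->] := probability_real P mS.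
rewrite -EFinM !lee_fin /c expRD -mulrA ger_pMr ?expR_gt0// => h.
by rewrite expRN -div1r ler_pdivlMr ?expR_gt0// mulrC.
Qed.

End exponential_inequality.

(** * Union bound over the traces of half-spaces *)

Lemma measure_bigsetU_le {R : realType} d (T : measurableType d)
    (mu : {measure set T -> \bar R}) (I : Type) (s : seq I) (F : I -> set T) :
  (forall i, measurable (F i)) ->
  (mu (\big[setU/set0]_(i <- s) F i) <= \sum_(i <- s) mu (F i))%E.
Proof.
move=> mF; elim: s => [|i s IH]; first by rewrite !big_nil measure0.
rewrite !big_cons; apply: (le_trans (measureU2 _ _ _)) => //.
  exact: bigsetU_measurable.
exact: leeD2l.
Qed.

Section rect_events.
Context {R : realType} {d0 : measure_display} {Omega : measurableType d0}.

Lemma rect_events_measurable d (X : 'I_d -> Omega -> R) :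
  (forall j, measurable_fun setT (X j)) -> rect_events d X `<=` measurable.
Proof.
move=> mX _ [B [mB ->]]; apply: (big_ind measurable) => //.
  exact: measurableI.
by move=> j _; rewrite -[_ @^-1` _]setTI; exact: mX.
Qed.

Lemma rect_events_setI d (X : 'I_d -> Omega -> R) : setI_closed (rect_events d X).
Proof.
move=> _ _ [A [mA ->]] [B [mB ->]]; exists (fun j => A j `&` B j); split.
  by move=> j; exact: measurableI.
by rewrite -big_split; apply: eq_bigr => j _; rewrite preimage_setI.
Qed.

Lemma rect_eventsT d (X : 'I_d -> Omega -> R) : rect_events d X setT.
Proof.
by exists (fun=> setT); split => //; rewrite big1.
Qed.

Lemma rect_events1 d (X : 'I_d -> Omega -> R) j (B : set R) : measurable B ->
  rect_events d X (X j @^-1` B).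
Proof.
move=> mB; exists (fun k => if k == j then B else setT); split.
  by move=> k; case: ifP.
apply/seteqP; split => w /=.
  by move=> Bw; apply/big_setIP => k _ /=; case: eqP => // ->.
by move=> /big_setIP/(_ j); rewrite mem_index_enum /= eqxx; exact.
Qed.

End rect_events.

(** Rational coefficients make the event that [A] is a trace a countable union, hence measurable
    with respect to the design; traces of closed real half-spaces are still covered. *)
Definition is_halfspace_pattern {R : realType} (n d : nat) (x : 'I_n -> 'I_d -> R)
    (A : {set 'I_n}) :=
  exists (g : {ffun 'I_d -> rat}) (b : rat), forall i,
    (i \in A) = (0 < \sum_j ratr (g j) * x i j + ratr b).

Lemma halfspace_patternP {R : realType} (n d : nat) (x : 'I_n -> 'I_d -> R)
    (g : 'I_d -> R) (b : R) (A : {set 'I_n}) :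
  (forall i, (i \in A) = (0 <= \sum_j g j * x i j + b)) ->
  is_halfspace_pattern x A.
Proof.
move=> Agb; have [g' [b' gb]] := halfspace_rat x g b.
by exists g', b' => i; rewrite Agb gb.
Qed.

Section pattern_concentration.
Context {R : realType} {d0 : measure_display} {Omega : measurableType d0}.
Variables (P : probability Omega R) (d : nat).
Variables (X : nat -> 'I_d -> {RV P >-> R}) (eps : nat -> {RV P >-> R}).

Let C (k : nat + nat) := match k with
  | inl i => rect_events d (fun j => (X i j : Omega -> R))
  | inr i => rv_events (eps i : Omega -> R)
  end.
Hypothesis indepC : mutual_indep P C.
Hypothesis ideps : forall i (B : set R), measurable B ->
  P ((eps i : Omega -> R) @^-1` B) = P ((eps 0%N : Omega -> R) @^-1` B).
Variable s2 : R.
Hypothesis eps1 : ('E_P[eps 0%N] = 0)%E.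
Hypothesis eps2 : (\int[P]_w ((eps 0%N w) ^+ 2)%:E = s2%:E)%E.

Let Cm k : C k `<=` measurable.
Proof. by case: k => i; [exact: rect_events_measurable|exact: rv_events_measurable]. Qed.

Let CI k : setI_closed (C k).
Proof. by case: k => i; [exact: rect_events_setI|exact: rv_events_setI]. Qed.

Let CT k : C k setT.
Proof. by case: k => i; [exact: rect_eventsT|exact: rv_eventsT]. Qed.

Lemma mutual_indep_noise : mutual_indep P (fun i => rv_events (eps i : Omega -> R)).
Proof.
move=> s us E sE.
have := indepC (s := map inr s) _ (E := fun k => if k is inr i then E i else setT).
rewrite map_inj_uniq ?us; last by move=> i j [].
rewrite !big_map; apply => // _ /mapP[i si ->]; exact: sE.
Qed.

Let bX n := block_events C (map inl (iota 0 n)).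
Let be n := block_events C (map inr (iota 0 n)).

Let mX n i j : (i < n)%N ->
  measurable_fun setT (X i j : g_sigma_algebraType (bX n) -> R).
Proof.
move=> ni _ B mB; rewrite setTI; apply: sub_sigma_algebra.
apply: (@block_events1 _ _ _ C CT _ (inl i)).
  by rewrite map_f// mem_iota.
exact: (@rect_events1 _ _ _ _ (fun j => (X i j : Omega -> R)) j).
Qed.

Let me n i : (i < n)%N ->
  measurable_fun setT (eps i : g_sigma_algebraType (be n) -> R).
Proof.
move=> ni _ B mB; rewrite setTI; apply: sub_sigma_algebra.
apply: (@block_events1 _ _ _ C CT _ (inr i)).
  by rewrite map_f// mem_iota.
by exists B.
Qed.

Let G n (A : {set 'I_n}) : set Omega :=
  [set w | is_halfspace_pattern (fun (i : 'I_n) j => X i j w) A].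

Let bG n (A : {set 'I_n}) : <<s bX n >> (G A).
Proof.
pose T := g_sigma_algebraType (bX n).
suff : measurable (G A : set T) by [].
rewrite (_ : G A = \bigcup_(z in [set: {ffun 'I_d -> rat} * rat])
    \bigcap_(i in [set: 'I_n]) [set w | (i \in A) =
      (0 < \sum_j ratr (z.1 j) * X i j w + ratr z.2)]); last first.
  apply/seteqP; split => w; first by move=> [g [b gb]]; exists (g, b) => // i _; exact: gb.
  by move=> [[g b] _ gb]; exists g, b => i; exact: gb.
apply: countable_bigcupT_measurable => // z.
apply: fin_bigcap_measurable => // i _.
have mh : measurable_fun setT
    (fun w : T => \sum_j ratr (z.1 j) * X i j w + ratr z.2 : R).
  apply: measurable_funD => //; apply: measurable_sum => j.
  by apply: measurable_funM => //; exact: mX.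
have mp : measurable ([set w : T | 0 < \sum_j ratr (z.1 j) * X i j w + ratr z.2]).
  rewrite (_ : [set w | _] = (fun w : T => \sum_j ratr (z.1 j) * X i j w + ratr z.2 : R)
      @^-1` `]0, +oo[%classic); last first.
    by apply/seteqP; split => w /=; rewrite in_itv/= andbT.
  by rewrite -[X in measurable X]setTI; exact: mh.
case: (i \in A).
  by rewrite (_ : [set w | _] = [set w : T | 0 < \sum_j ratr (z.1 j) * X i j w + ratr z.2])//;
    apply/seteqP; split => w /= => [<-//|->].
rewrite (_ : [set w | _] = ~` [set w : T | 0 < \sum_j ratr (z.1 j) * X i j w + ratr z.2]).
  exact: measurableC.
by apply/seteqP; split => w /= => [<-//|/negP/negbTE ->].
Qed.

Variables (lam t : R).

Let H n (u : R) (A : {set 'I_n}) : set Omega :=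
  [set w | n%:R * (lam ^+ 2 * s2) + t <
     lam * \sum_(i < n) (u * (i \in A)%:R) * eps i w
     - lam ^+ 2 * \sum_(i < n) eps i w ^+ 2].

Let bH n u A : <<s be n >> (@H n u A).
Proof.
pose T := g_sigma_algebraType (be n).
suff : measurable (H u A : set T) by [].
rewrite (_ : H u A = (fun w : T => lam * \sum_(i < n) (u * (i \in A)%:R) * eps i w
     - lam ^+ 2 * \sum_(i < n) eps i w ^+ 2 : R) @^-1`
       `]n%:R * (lam ^+ 2 * s2) + t, +oo[%classic); last first.
  by apply/seteqP; split => w /=; rewrite in_itv/= andbT.
rewrite -[X in measurable X]setTI; suff mh : measurable_fun setT
   (fun w : T => lam * \sum_(i < n) (u * (i \in A)%:R) * eps i w
     - lam ^+ 2 * \sum_(i < n) eps i w ^+ 2 : R) by exact: mh.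
apply: measurable_funB.
  apply: measurable_funM => //; apply: measurable_sum => i.
  by apply: measurable_funM => //; exact: me.
apply: measurable_funM => //; apply: measurable_sum => i.
by apply: measurable_funX; exact: me.
Qed.

Let pH n u A : u ^+ 2 <= 1 -> (P (@H n u A) <= (expR (- t))%:E)%E.
Proof.
move=> u1.
(* The weights on ['I_n] are extended by 0 to all indices. *)
pose s (i : nat) := if insub i is Some j then u * (j \in A)%:R else 0 : R.
have sumE w : \sum_(i < n) s i * eps i w = \sum_(i < n) (u * (i \in A)%:R) * eps i w.
  by apply: eq_bigr => i _; rewrite /s valK.
have := @prob_self_normalized_sum _ _ _ P eps mutual_indep_noise ideps s2 eps1 eps2
  lam t s n.
rewrite (_ : [set w | _] = H u A).
  apply=> i; rewrite /s; case: insub => [j|]; last by rewrite expr0n.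
  by case: (j \in A); rewrite ?mulr1 ?mulr0 ?expr0n.
by apply/seteqP; split => w; rewrite /H /= sumE.
Qed.

(** Design and noise being independent, a set [A] costs [exp(- t)] times the probability that [A] is
    a trace, so the union bound pays for the expected number of traces and not for all subsets. The
    factor 2 accounts for the signs [u = 1] and [u = -1], which yield the absolute value. *)
Lemma prob_pattern_sums n :
  exists N : set Omega, [/\ measurable N,
    (P N <= (2 * (n.+1 ^ d.+1)%:R * expR (- t))%:E)%E &
    forall w, ~ N w -> forall A : {set 'I_n},
      is_halfspace_pattern (fun (i : 'I_n) j => X i j w) A ->
      lam * `|\sum_(i in A) eps i w| <=
        n%:R * (lam ^+ 2 * s2) + t + lam ^+ 2 * \sum_(i < n) eps i w ^+ 2].
Proof.
have indGH u A : u ^+ 2 <= 1 -> [/\ measurable (G A `&` @H n u A), measurable (G A) &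
    (P (G A `&` @H n u A) <= (expR (- t))%:E * P (G A))%E].
  move=> u1.
  have [|mG mH ->] := block_events_indep indepC Cm CI _ (bG A) (bH u A).
    rewrite cat_uniq !map_inj_uniq ?iota_uniq/= ?andbT; try by move=> ? ? [].
    by apply/hasPn => _ /mapP[i _ ->]; apply/negP => /mapP[].
  split => //; first exact: measurableI.
  by rewrite muleC lee_wpmul2r// pH.
pose N u := \big[setU/set0]_(A : {set 'I_n}) (G A `&` @H n u A).
have u1 : (1 : R) ^+ 2 <= 1 by rewrite expr1n.
have uN1 : (-1 : R) ^+ 2 <= 1 by rewrite sqrrN expr1n.
have mN u : u ^+ 2 <= 1 -> measurable (N u).
  by move=> hu; apply: bigsetU_measurable => A _; have [] := indGH u A hu.
have pN u : u ^+ 2 <= 1 -> (P (N u) <= ((n.+1 ^ d.+1)%:R * expR (- t))%:E)%E.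
  move=> hu; apply: (le_trans (measure_bigsetU_le _ _ _)).
    by move=> A; have [] := indGH u A hu.
  apply: (@le_trans _ _ (\sum_(A : {set 'I_n}) (expR (- t))%:E * P (G A))%E).
    by apply: lee_sum => A _; have [] := indGH u A hu.
  rewrite -ge0_sume_distrr// mulrC EFinM lee_wpmul2l// ?lee_fin ?expR_ge0//.
  (* This sum is the expected number of traces, which is polynomial in [n] pointwise. *)
  have -> : (\sum_(A : {set 'I_n}) P (G A) =
             \int[P]_w (\sum_(A : {set 'I_n}) (\1_(G A) w)%:E))%E.
    rewrite ge0_integral_sum//; last first.
      move=> A; apply/measurable_EFinP/measurable_indic.
      by have [] := indGH 1 A u1.
    by apply: eq_bigr => A _; rewrite integral_indic ?setIT//; have [] := indGH 1 A u1.
  apply: (@le_trans _ _ (\int[P]_w (cst (n.+1 ^ d.+1)%:R%:E w))%E); last first.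
    by rewrite integral_cst// [X in (_ * X)%E](probability_setT P) mule1.
  apply: ge0_le_integral => //.
  - by move=> w _; apply: sume_ge0 => A _; rewrite lee_fin.
  - apply: emeasurable_sum => A; apply/measurable_EFinP/measurable_indic.
    by have [] := indGH 1 A u1.
  move=> w _ /=; rewrite sumEFin lee_fin.
  pose F := [set A : {set 'I_n} | `[< G A w >]]%SET.
  rewrite (_ : \sum_A \1_(G A) w = #|F|%:R).
    rewrite ler_nat; apply: (@card_halfspace_patterns R n d (fun i j => X i j w)).
    move=> A; rewrite inE => /asboolP[g [b gb]].
    by exists (fun j => ratr (g j)), (ratr b).
  rewrite -sum1_card natr_sum [in RHS]big_mkcond/=; apply: eq_bigr => A _.
  rewrite indicE; case: ifPn => [|/negP AF].
    by rewrite inE => /asboolP h; rewrite mem_set.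
  by rewrite memNset// => h; apply: AF; rewrite inE; apply/asboolP.
exists (N 1 `|` N (-1)); split.
- by apply: measurableU; exact: mN.
- apply: (le_trans (measureU2 _ _ _)); try exact: mN.
  rewrite (_ : 2 * _ * _ = (n.+1 ^ d.+1)%:R * expR (- t) + (n.+1 ^ d.+1)%:R * expR (- t));
    last by ring.
  by rewrite EFinD leeD// pN.
move=> w nN A GA.
have key u : u ^+ 2 <= 1 -> ~ N u w -> lam * (u * \sum_(i in A) eps i w) <=
        n%:R * (lam ^+ 2 * s2) + t + lam ^+ 2 * \sum_(i < n) eps i w ^+ 2.
  move=> hu nNu; rewrite leNgt; apply/negP => h; apply: nNu.
  rewrite /N -bigcup_seq; exists A; first by rewrite /= mem_index_enum.
  split => //; rewrite /H /= ltrBrDr.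
  rewrite (_ : \sum_(i < n) _ * _ * eps i w = u * \sum_(i in A) eps i w)//.
  rewrite [in RHS]big_mkcond mulr_sumr; apply: eq_bigr => i _.
  by case: (i \in A); rewrite ?mulr1 ?mulr0 ?mul0r.
have [h|h] := leP 0 (\sum_(i in A) eps i w).
  by rewrite (ger0_norm h) -[X in lam * X]mul1r; apply: key => // ?; apply: nN; left.
by rewrite (ltr0_norm h) -mulN1r; apply: key => // ?; apply: nN; right.
Qed.

End pattern_concentration.

(** * Control of the noise for all large [n] by Borel-Cantelli *)

(** The subtracted term, of the order of the remainder of the series, makes the induction close. *)
Lemma sum_inv_sqr_le {R : realFieldType} N :
  \sum_(0 <= n < N.+1) 2 * n.+1%:R ^- 2 <= 4 - 2 / N.+1%:R :> R.
Proof.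
elim: N => [|N IH]; first by rewrite big_nat1 expr1n invr1; lra.
rewrite big_nat_recr//=; apply: (le_trans (lerD IH (lexx _))).
have x0 : 0 < N.+1%:R :> R by [].
have -> : N.+2%:R = N.+1%:R + 1 :> R by rewrite -natr1.
move: (N.+1%:R : R) x0 => x x0.
have x10 : 0 < x + 1 by lra.
rewrite -subr_ge0 (_ : _ - _ = 2 / (x * (x + 1) ^+ 2)); last first.
  by field; rewrite !gt_eqF.
by rewrite divr_ge0// mulr_ge0 ?sqr_ge0// ltW.
Qed.

Section noise_event.
Context {R : realType} {d0 : measure_display} {Omega : measurableType d0}.
Variables (P : probability Omega R) (d : nat).
Variables (X : nat -> 'I_d -> {RV P >-> R}) (eps : nat -> {RV P >-> R}).
Hypothesis hind : mutual_indep P (fun k : nat + nat =>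
  match k with
  | inl i => rect_events d (fun j => (X i j : Omega -> R))
  | inr i => rv_events (eps i : Omega -> R)
  end).
Hypothesis hideps : forall i (B : set R), measurable B ->
  P ((eps i : Omega -> R) @^-1` B) = P ((eps 0%N : Omega -> R) @^-1` B).
Variable s2 : R.
Hypothesis eps1 : ('E_P[eps 0%N] = 0)%E.
Hypothesis eps2 : (\int[P]_w ((eps 0%N w) ^+ 2)%:E = s2%:E)%E.

Let lnn (n : nat) : R := ln n.+1%:R.

Lemma noise_event (delta : R) : 0 < delta ->
  exists (A : set Omega) (K : R), [/\ measurable A, ((1 - delta)%:E <= P A)%E,
    0 <= K & forall w, A w -> \forall n \near \oo, forall S : {set 'I_n},
      is_halfspace_pattern (fun (i : 'I_n) j => X i j w) S ->
      `|\sum_(i in S) eps i w| <= K * Num.sqrt (n%:R * ln n.+1%:R)].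
Proof.
move=> delta0.
have s20 : 0 <= s2.
  by rewrite -lee_fin -eps2 integral_ge0// => w _; rewrite lee_fin sqr_ge0.
(* This makes [s2 / B <= delta]; the added 1 keeps [B] positive when [s2] is 0. *)
pose B := (s2 + 1) / delta.
have B0 : 0 < B by rewrite divr_gt0// ltr_wpDl.
have sB : s2 / B <= delta.
  rewrite ler_pdivrMr// /B mulrC divfK ?gt_eqF//; lra.
have [Q [mQ pQ QB]] := prob_sum_sqr_gt (mutual_indep_noise hind) hideps B0 eps2.
(* This gives [n lam^2 = ln (n + 1)]. With [t = (d + 3) ln (n + 1)], the factor [exp(- t)] absorbs
   the [(n + 1)^(d + 1)] traces and leaves the summable [(n + 1)^-2]. *)
pose lam n : R := Num.sqrt (lnn n / n%:R).
have /choice[N NP] n := prob_pattern_sums hind hideps eps1 eps2 (lam n)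
  ((d.+3)%:R * lnn n) n.
have mN n : measurable (N n) by have [] := NP n.
have pN n : (P (N n) <= (2 * n.+1%:R ^- 2)%:E)%E.
  have [_ + _] := NP n; move=> /le_trans; apply; rewrite lee_fin.
  rewrite expRN expRM_natl lnK ?posrE// natrX.
  have -> : (d.+3 = d.+1 + 2)%N by rewrite addn2.
  rewrite exprD.
  by rewrite -mulrA invfM mulVKf// expf_neq0.
have limN : P (lim_sup_set N) = 0%E.
  apply: lim_sup_set_cvg0 => //.
  apply: (@le_lt_trans _ _ 4%:E); last exact: ltry.
  apply: lime_le; first by apply: is_cvg_nneseries => k _ _.
  apply: nearW => -[|M]; first by rewrite big_geq.
  apply: (@le_trans _ _ (\sum_(0 <= n < M.+1) (2 * n.+1%:R ^- 2)%:E)%E).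
    by apply: lee_sum => n _; exact: pN.
  rewrite sumEFin lee_fin (le_trans (sum_inv_sqr_le M))//.
  by rewrite gerBl divr_ge0.
have mlim : measurable (lim_sup_set N).
  apply: bigcapT_measurable => n; apply: bigcup_measurable => k _; exact: mN.
(* The constant collects the three terms of the deviation bound, each at most a multiple of
   [ln (n + 1) = lam n * sqrt (n ln (n + 1))]. Only [Q] costs probability. *)
exists (~` (Q `|` lim_sup_set N)), (B + s2 + d.+3%:R); split.
- by apply: measurableC; exact: measurableU.
- rewrite probability_setC; last exact: measurableU.
  rewrite EFinB leeB//; apply: (le_trans (measureU2 _ _ _)) => //.
  by rewrite [X in (_ + X)%E]limN adde0 (le_trans pQ)// lee_fin.
- by rewrite !addr_ge0// ltW.
move=> w; rewrite setCU => -[/QB Qw nlim].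
have [n0 n0P] : exists n0, forall n, (n0 <= n)%N -> ~ N n w.
  apply: contrapT => h; apply: nlim => n _.
  apply: contrapT => h'; apply: h; exists n => m nm Nm; apply: h'.
  by exists m.
near=> n => S patS.
have n_gt0 : (0 < n)%N by near: n; exact: nbhs_infty_gt.
have n0n : (n0 <= n)%N by near: n; exact: nbhs_infty_ge.
have [_ _ /(_ w (n0P n n0n) S patS)] := NP n.
have L0 : 0 < lnn n by rewrite ln_gt0// ltr1n.
have nR : 0 < n%:R :> R by rewrite ltr0n.
have lam0 : 0 < lam n by rewrite sqrtr_gt0 divr_gt0.
have lam2 : lam n ^+ 2 = lnn n / n%:R by rewrite sqr_sqrtr// divr_ge0// ltW.
have nlam2 : n%:R * lam n ^+ 2 = lnn n by rewrite lam2 mulrC divfK// gt_eqF.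
have lamS : lam n * Num.sqrt (n%:R * lnn n) = lnn n.
  rewrite -sqrtrM; last by rewrite divr_ge0// ltW.
  by rewrite mulrA divfK ?gt_eqF// -expr2 sqrtr_sqr gtr0_norm.
move=> h; rewrite -(ler_pM2l lam0); apply: le_trans h _.
rewrite (mulrCA (lam n)) lamS -/(lnn n).
have := Qw n => hQ.
have : lam n ^+ 2 * \sum_(i < n) eps i w ^+ 2 <= lnn n * B.
  rewrite -nlam2 -mulrA (mulrCA n%:R) ler_wpM2l ?sqr_ge0//.
  by rewrite mulrC.
rewrite mulrA nlam2 !mulrDl; lra.
Unshelve. all: by end_near. Qed.

End noise_event.

(** * Correlation of the noise with a network *)

(** The logistic form shows at once that [1 + tanh] is increasing with values between 0 and 2. *)
Lemma tanh1E {R : realType} (x : R) : 1 + tanh x = 2 / (1 + expR (- (2 * x))).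
Proof.
rewrite /tanh; have -> : expR (- (2 * x)) = expR (- x) * expR (- x).
  by rewrite -expRD; congr expR; ring.
have h : expR x * expR (- x) = 1 by rewrite -expRD subrr expR0.
have := expR_gt0 x; have := expR_gt0 (- x); move: h.
move: (expR x) (expR (- x)) => a b ab b0 a0.
have ab0 : 0 < a + b by exact: addr_gt0.
have bb0 : 0 < 1 + b * b by rewrite addr_gt0// mulr_gt0.
have -> : 1 + (a - b) / (a + b) = 2 * a / (a + b) by field; rewrite gt_eqF.
have -> : a + b = a * (1 + b * b) by rewrite mulrDr mulrA ab mulr1 mul1r.
by field; rewrite !gt_eqF.
Qed.

Section net_noise.
Context {R : realType} (n d : nat).
Variables (x : 'I_n -> 'rV[R]_d) (e : 'I_n -> R) (T : R).
Hypothesis T0 : 0 <= T.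
Hypothesis eT : forall S : {set 'I_n},
  is_halfspace_pattern (fun i j => x i ord0 j) S -> `|\sum_(i in S) e i| <= T.

Let sum_le : `|\sum_i e i| <= T.
Proof.
rewrite (eq_bigl (fun i => i \in [set: 'I_n]%SET)); last by move=> i; rewrite inE.
(* The degenerate half-space [0 <= 0] contains the whole sample. *)
apply: eT; apply: (@halfspace_patternP _ _ _ _ (fun=> 0) 0) => i.
by rewrite inE big1 ?addr0 ?lexx// => j _; rewrite mul0r.
Qed.

(** The superlevel sets of [1 + tanh] of an affine function are half-spaces, so Abel summation gives
    [2 T]; subtracting the constant 1 costs one more [T]. *)
Lemma neuron_noise (g : 'I_d -> R) (b : R) :
  `|\sum_i e i * tanh (\sum_(j < d) g j * x i ord0 j + b)| <= 3 * T.
Proof.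
pose u i := \sum_(j < d) g j * x i ord0 j + b.
pose v i := 1 + tanh (u i).
have den0 y : 0 < 1 + expR (- (2 * y)) :> R by rewrite addr_gt0// expR_gt0.
have vuP i j : (v j <= v i) = (u j <= u i).
  rewrite /v !tanh1E ler_pM2l// lef_pV2 ?posrE// lerD2l ler_expR lerN2.
  by rewrite ler_pM2l.
have : `|\sum_i e i * v i| <= 2 * T.
  apply: abel_superlevel => // [i|j _].
    rewrite /v tanh1E; apply/andP; split; first by rewrite divr_ge0// ltW.
    by rewrite ler_pdivrMr// ler_peMr// lerDl expR_ge0.
  rewrite (eq_bigl (fun i => i \in [set i | u j <= u i]%SET)); last first.
    by move=> i; rewrite inE vuP.
  apply: eT; apply: (@halfspace_patternP _ _ _ _ g (b - u j)) => i.
  by rewrite inE addrA subr_ge0.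
rewrite (_ : \sum_i e i * v i = \sum_i e i + \sum_i e i * tanh (u i)); last first.
  by rewrite -big_split; apply: eq_bigr => i _; rewrite /v mulrDr mulr1.
move=> h; have := sum_le; move: h.
rewrite -/u; move: (\sum_i e i) (\sum_i e i * tanh (u i)) => a c.
by rewrite !ler_norml; lra.
Qed.

(** The network is linear in its output weights, whose absolute values sum to at most [V]; the
    intercept, with bound [T], fits under [3 T] as well. *)
Lemma net_noise r th V M : admissible d r V M th ->
  `|\sum_i e i * net d r th (x i)| <= V * (3 * T).
Proof.
move=> [aV _].
have -> : \sum_i e i * net d r th (x i) = nn_alpha th 0 * (\sum_i e i) +
    \sum_(1 <= j < r.+1) nn_alpha th j *
      (\sum_i e i * tanh (\sum_(k < d) nn_gamma th k.+1 j * x i ord0 k + nn_gamma th 0 j)).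
  rewrite mulr_sumr /net; under eq_bigr do rewrite mulrDr.
  rewrite big_split/=; congr (_ + _).
    by apply: eq_bigr => i _; rewrite mulrC.
  under eq_bigr do rewrite mulr_sumr.
  rewrite exchange_big/=; apply: eq_bigr => j _.
  by rewrite mulr_sumr; apply: eq_bigr => i _; rewrite mulrCA.
apply: (@le_trans _ _ ((\sum_(0 <= j < r.+1) `|nn_alpha th j|) * (3 * T))); last first.
  by rewrite ler_wpM2r// mulr_ge0.
rewrite [X in _ <= X * _]big_ltn// mulrDl; apply: (le_trans (ler_normD _ _)); apply: lerD.
  rewrite normrM; apply: ler_wpM2l => //; apply: (le_trans sum_le).
  by rewrite ler_peMl// ler1n.
rewrite mulr_suml; apply: (le_trans (ler_norm_sum _ _ _)).
by apply: ler_sum => j _; rewrite normrM ler_wpM2l// neuron_noise.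
Qed.

End net_noise.

(** * Padding a network with zero weights *)

(** Input weights are cut off as well as output weights, because the penalty charges both. *)
Definition pad_param {R : realType} (r : nat) (th : nnparam R) : nnparam R :=
  NNParam _ (fun j => if (j <= r)%N then nn_alpha th j else 0)
          (fun i j => if (j <= r)%N then nn_gamma th i j else 0).

Lemma sum_nat_widen (V : zmodType) (F G : nat -> V) a r0 r :
  (a <= r0.+1)%N -> (r0 <= r)%N ->
  (forall j, (j <= r0)%N -> F j = G j) -> (forall j, (r0 < j)%N -> F j = 0) ->
  \sum_(a <= j < r.+1) F j = \sum_(a <= j < r0.+1) G j.
Proof.
move=> ar r0r FG F0; rewrite (@big_cat_nat _ _ _ r0.+1)//=.
rewrite [X in _ + X]big_nat_cond [X in _ + X]big1 ?addr0; last first.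
  by move=> j /andP[/andP[rj _] _]; exact: F0.
by apply: eq_big_nat => j /andP[_ jr]; exact: FG.
Qed.

Section pad_param.
Context {R : realType} (d r0 r : nat) (th : nnparam R).
Hypothesis r0r : (r0 <= r)%N.

Let padF j : (r0 < j)%N -> (j <= r0)%N = false.
Proof. by move=> h; rewrite leqNgt h. Qed.

Lemma net_pad : net d r (pad_param r0 th) = net d r0 th.
Proof.
apply/funext => x; rewrite /net; congr (_ + _).
apply: sum_nat_widen => // j h /=; last by rewrite padF// mul0r.
by rewrite h.
Qed.

Lemma Jpen_pad : Jpen d r (pad_param r0 th) = Jpen d r0 th.
Proof.
congr (_ + _).
  by apply: sum_nat_widen => // j h /=; [rewrite h|rewrite padF// normr0].
apply: eq_bigr => i _.
by apply: sum_nat_widen => // j h /=; [rewrite h|rewrite padF// normr0].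
Qed.

Lemma admissible_pad V0 M0 V M : V0 <= V -> M0 <= M -> 0 <= M ->
  admissible d r0 V0 M0 th -> admissible d r V M (pad_param r0 th).
Proof.
move=> VV MM M00 [aV gM]; split.
  rewrite (@sum_nat_widen _ _ (fun j => `|nn_alpha th j|) 0 r0) ?(le_trans aV)//.
    by move=> j h /=; rewrite h.
  by move=> j h /=; rewrite padF// normr0.
move=> j /andP[j1 jr] /=; case: (leqP j r0) => jr0; last first.
  by rewrite normr0 big1_eq.
by rewrite (le_trans (gM j _))// j1.
Qed.

End pad_param.

(** * Consequences of the growth condition *)

Section rate.
Context {R : realType} (r : nat -> nat) (V : nat -> R).
Hypothesis hr : (fun n => (r n)%:R : R) @ \oo --> +oo.
Hypothesis hV1 : forall n, 1 < V n.
Hypothesis hrate :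
  (fun n => (r n)%:R * V n ^+ 2 * ln ((r n)%:R * V n) / n%:R) @ \oo --> 0.

Lemma sieve_width_ge k : \forall n \near \oo, (k <= r n)%N.
Proof.
have /cvgryPge/(_ k%:R) := hr.
by apply: filterS => n; rewrite ler_nat.
Qed.

Let expR_ln_cvg0 : (fun n => 8 * expR (- (ln n.+1%:R / 4)) : R) @ \oo --> 0.
Proof.
rewrite -[X in _ --> X](mulr0 8); apply: cvgMr.
apply/cvgr0Pnorm_le => e e0; near=> n.
rewrite ger0_norm ?expR_ge0// -[leRHS]lnK ?posrE// ler_expR.
suff : - 4 * ln e <= ln n.+1%:R :> R by lra.
rewrite -ler_expR lnK ?posrE//.
apply: (@le_trans _ _ n%:R); last by rewrite ler_nat.
near: n; exact: nbhs_infty_ger.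
Unshelve. all: by end_near. Qed.

(** If [V^4 <= n + 1], then [V^2 <= (n + 1)^(1/2)] and [ln (n + 1) <= 4 (n + 1)^(1/4)], and
    [n + 1 <= 2 n] gives the bound [8 (n + 1)^(-1/4)]. Otherwise [ln (n + 1) < 4 ln V <= 4 ln (r V)]
    and the growth condition applies. *)
Lemma variation_rate : (fun n => V n ^+ 2 * ln n.+1%:R / n%:R) @ \oo --> 0.
Proof.
have cub : (fun n => 8 * expR (- (ln n.+1%:R / 4)) +
    4 * ((r n)%:R * V n ^+ 2 * ln ((r n)%:R * V n) / n%:R)) @ \oo --> (0 : R).
  rewrite -[X in _ --> X](addr0 0); apply: cvgD; first exact: expR_ln_cvg0.
  by rewrite -[X in _ --> X](mulr0 4); apply: cvgMr.
apply: (squeeze_cvgr _ (cvg_cst 0) cub).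
near=> n.
have n0 : (0 < n)%N by near: n; exact: nbhs_infty_gt.
have r0 : (0 < r n)%N by near: n; exact: sieve_width_ge.
have nR : 0 < n%:R :> R by rewrite ltr0n.
have rR : 1 <= (r n)%:R :> R by rewrite ler1n.
have V1 := hV1 n; have V0 : 0 < V n by lra.
have y0 : 0 < ln n.+1%:R :> R by rewrite ln_gt0// ltr1n.
have lV : ln (V n) <= ln ((r n)%:R * V n).
  by rewrite ler_ln ?posrE ?mulr_gt0 ?ltr0n// ler_peMl// ltW.
have lV0 : 0 < ln (V n) by rewrite ln_gt0.
apply/andP; split; first by rewrite divr_ge0// mulr_ge0 ?sqr_ge0// ltW.
have [yV|yV] := leP (4 * ln (V n)) (ln n.+1%:R).
  apply: (@le_trans _ _ (8 * expR (- (ln n.+1%:R / 4)))); last first.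
    rewrite lerDl mulr_ge0// divr_ge0// mulr_ge0; last by rewrite (le_trans (ltW lV0)).
      by [].
    by rewrite mulr_ge0// sqr_ge0.
  set y := ln n.+1%:R : R in y0 yV *.
  have Vy : V n ^+ 2 <= expR (y / 2).
    by rewrite -(lnK (_ : V n \is Num.pos)) ?posrE// -expRM_natl ler_expR; lra.
  have yy : y <= 4 * expR (y / 4).
    by have := expR_ge1Dx (y / 4); lra.
  have ny : expR y <= 2 * n%:R.
    by rewrite lnK ?posrE// -natrM ler_nat; lia.
  rewrite ler_pdivrMr//.
  apply: (@le_trans _ _ (expR (y / 2) * (4 * expR (y / 4)))).
    by apply: ler_pM => //; [exact: sqr_ge0|exact: ltW].
  have -> : expR (y / 2) * (4 * expR (y / 4)) = 4 * expR (- (y / 4)) * expR y.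
    rewrite mulrCA -mulrA -!expRD; congr (_ * expR _); lra.
  rewrite (_ : 8 * _ * _ = 4 * expR (- (y / 4)) * (2 * n%:R)); last by ring.
  by rewrite ler_wpM2l// mulr_ge0// expR_ge0.
apply: (@le_trans _ _ (4 * ((r n)%:R * V n ^+ 2 * ln ((r n)%:R * V n) / n%:R))); last first.
  by rewrite lerDr mulr_ge0// expR_ge0.
rewrite mulrA ler_pM2r ?invr_gt0//.
apply: (@le_trans _ _ (V n ^+ 2 * (4 * ln (V n)))).
  by rewrite ler_wpM2l ?sqr_ge0// ltW.
rewrite mulrCA ler_wpM2l// -[leLHS]mul1r -mulrA.
apply: ler_pM => //; first by rewrite mulr_ge0 ?sqr_ge0// ltW.
by rewrite ler_wpM2l// sqr_ge0.
Unshelve. all: by end_near. Qed.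

End rate.

(** * Basic inequality and convergence along a sample path *)

Lemma Jpen_ge0 {R : realType} d r (th : nnparam R) : 0 <= Jpen d r th.
Proof. by rewrite addr_ge0// ?sumr_ge0// => i _; rewrite sumr_ge0. Qed.

(** Nonnegativity of [lam] bounds the criterion below by 0, so that [inf] is a genuine infimum. *)
Lemma Qinf_le {R : realType} d r n (V M lam : R) Xs Ys th : 0 <= lam ->
  admissible d r V M th ->
  Qinf d r n V M lam Xs Ys <= Qtilde d r n lam Xs Ys th.
Proof.
move=> lam0 thA; apply: ge_inf; last by exists th.
exists 0 => _ [th' _ <-]; rewrite addr_ge0 ?mulr_ge0 ?Jpen_ge0//.
by rewrite sumr_ge0// => i _; rewrite sqr_ge0.
Qed.

(** The sum of the [e i ^+ 2] is the same for all parameters and cancels when two of them are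
    compared. *)
Lemma Qtilde_sub {R : realType} d r n (lam : R) Xs (f0 : 'rV[R]_d -> R)
    (e : nat -> R) th :
  Qtilde d r n lam Xs (fun i => f0 (Xs i) + e i) th =
  n%:R^-1 * \sum_(i < n) (net d r th (Xs i) - f0 (Xs i)) ^+ 2
  - 2 * (n%:R^-1 * \sum_(i < n) e i * (net d r th (Xs i) - f0 (Xs i)))
  + n%:R^-1 * \sum_(i < n) e i ^+ 2 + lam * Jpen d r th.
Proof.
rewrite /Qtilde; congr (_ + _).
rewrite mulrCA -mulrBr -mulrDr; congr (_ * _).
rewrite mulr_sumr -sumrB -big_split; apply: eq_bigr => i _ /=; ring.
Qed.

(** Once [r n >= 1], the minimum is at most [r^(-1/2) <= 1], whatever [b], so dividing by it can
    only increase [lam n]. *)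
Lemma lambda_cvg0 {R : realType} (r : nat -> nat) (lam : nat -> R) (b : R) :
  (fun n => (r n)%:R : R) @ \oo --> +oo -> (forall n, 0 <= lam n) ->
  (fun n => lam n / Num.min ((r n)%:R `^ (- 2^-1)) ((r n)%:R `^ b)) @ \oo --> 0 ->
  lam @ \oo --> 0.
Proof.
move=> hr lam0 hlam; apply: (squeeze_cvgr _ (cvg_cst 0) hlam).
near=> n; rewrite lam0/=.
have r0 : (0 < r n)%N by near: n; exact: (sieve_width_ge hr 1%N).
have rR : 1 <= (r n)%:R :> R by rewrite ler1n.
have min0 : 0 < Num.min ((r n)%:R `^ (- 2^-1)) ((r n)%:R `^ b).
  by rewrite lt_min !powR_gt0// ltr0n.
rewrite ler_pdivlMr// ler_piMr// ge_min; apply/orP; left.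
by rewrite -[leRHS](powRr0 (r n)%:R) ler_powR// oppr_le0 invr_ge0.
Unshelve. all: by end_near. Qed.

(** The deterministic half of the proof, along one sample path. To reach [a ^+ 2], approximation
    error, noise, penalty of the competitor and optimization error receive [a ^+ 2 / 4] each. *)
Lemma emp_norm_cvg0 {R : realType} (d : nat) (Xc : set 'rV[R]_d)
    (f0 : 'rV[R]_d -> R) (r : nat -> nat) (V M : nat -> R) (pif0 : nat -> 'rV[R]_d -> R)
    (eta lam : nat -> R) (C K : R)
    (x : nat -> 'rV[R]_d) (e : nat -> R) (th : nat -> nnparam R) :
  (fun n => (r n)%:R : R) @ \oo --> +oo -> V @ \oo --> +oo -> M @ \oo --> +oo ->
  (forall n, 1 < V n) -> (forall n, 0 < M n) ->
  (forall n, Fnet d (r n) (V n) (M n) (pif0 n)) ->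
  (forall e : R, 0 < e -> \forall n \near \oo,
     forall x, Xc x -> `|pif0 n x - f0 x| <= e) ->
  (fun n => (r n)%:R * V n ^+ 2 * ln ((r n)%:R * V n) / n%:R) @ \oo --> 0 ->
  eta @ \oo --> 0 -> (forall n, 0 <= lam n) -> lam @ \oo --> 0 ->
  (forall n, admissible d (r n) (V n) (M n) (th n)) ->
  (\forall n \near \oo,
     Qtilde d (r n) n (lam n) x (fun i => f0 (x i) + e i) (th n)
     <= Qinf d (r n) n (V n) (M n) (lam n) x (fun i => f0 (x i) + e i) + C * eta n) ->
  (forall i, Xc (x i)) -> 0 <= K ->
  (\forall n \near \oo, forall S : {set 'I_n},
      is_halfspace_pattern (fun (i : 'I_n) j => x i ord0 j) S ->
      `|\sum_(i in S) e i| <= K * Num.sqrt (n%:R * ln n.+1%:R)) ->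
  (fun n => emp_norm d n x (fun y => net d (r n) (th n) y - f0 y)) @ \oo --> 0.
Proof.
move=> hr hV hM hV1 hM0 hpif hpif_cvg hrate heta lam0 lam_cvg hth hQ xXc K0 hK.
apply/cvgr0Pnorm_le => a a0.
have a20 : 0 < a ^+ 2 / 4 by rewrite divr_gt0 ?exprn_gt0.
(* The index [m] depends on [a] only, so the penalty of the competitor is constant in [n]. *)
have [m hm] : exists m, forall y, Xc y -> `|pif0 m y - f0 y| <= a / 2.
  have a2 : 0 < a / 2 by rewrite divr_gt0.
  have [m _ mP] := hpif_cvg _ a2; exists m; apply: mP; exact: leqnn.
have [th0 [th0A th0E]] := hpif m.
have cV := variation_rate hr hV1 hrate.
(* The constant is [2 * 2 * 3]: the cross term of the square, the two networks compared, and the 3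
   of [net_noise]. *)
have cS : (fun n => 12 * K * Num.sqrt (V n ^+ 2 * ln n.+1%:R / n%:R)) @ \oo --> (0 : R).
  have c0 : (fun n => Num.sqrt (V n ^+ 2 * ln n.+1%:R / n%:R)) @ \oo --> (0 : R).
    by rewrite -[X in _ --> X]sqrtr0; apply: continuous_cvg => //; exact: sqrt_continuous.
  by rewrite -[X in _ --> X](mulr0 (12 * K)); apply: cvgMr.
have cJ : (fun n => lam n * Jpen d (r m) th0) @ \oo --> (0 : R).
  by rewrite -[X in _ --> X](mul0r (Jpen d (r m) th0)); apply: cvgMl.
have cE : (fun n => C * eta n) @ \oo --> (0 : R).
  by rewrite -[X in _ --> X](mulr0 C); apply: cvgMr.
move/cvgr0Pnorm_le/(_ _ a20) in cS.
move/cvgr0Pnorm_le/(_ _ a20) in cJ.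
move/cvgr0Pnorm_le/(_ _ a20) in cE.
near=> n.
have n0 : (0 < n)%N by near: n; exact: nbhs_infty_gt.
have nR : 0 < n%:R :> R by rewrite ltr0n.
have rmn : (r m <= r n)%N by near: n; exact: (sieve_width_ge hr (r m)).
have Vmn : V m <= V n by near: n; by move/cvgryPge: hV; exact.
have Mmn : M m <= M n by near: n; by move/cvgryPge: hM; exact.
have bS : `|12 * K * Num.sqrt (V n ^+ 2 * ln n.+1%:R / n%:R)| <= a ^+ 2 / 4 by near: n.
have bJ : `|lam n * Jpen d (r m) th0| <= a ^+ 2 / 4 by near: n.
have bE : `|C * eta n| <= a ^+ 2 / 4 by near: n.
have bK : forall S : {set 'I_n},
      is_halfspace_pattern (fun (i : 'I_n) j => x i ord0 j) S ->
      `|\sum_(i in S) e i| <= K * Num.sqrt (n%:R * ln n.+1%:R) by near: n.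
have bQ : Qtilde d (r n) n (lam n) x (fun i => f0 (x i) + e i) (th n)
     <= Qinf d (r n) n (V n) (M n) (lam n) x (fun i => f0 (x i) + e i) + C * eta n.
  by near: n.
set T := K * Num.sqrt (n%:R * ln n.+1%:R) in bK.
have T0 : 0 <= T by rewrite mulr_ge0.
pose th1 := pad_param (r m) th0.
have th1A : admissible d (r n) (V n) (M n) th1.
  by apply: (admissible_pad rmn Vmn Mmn); [exact: ltW|exact: th0A].
have th1E : net d (r n) th1 = pif0 m by rewrite net_pad.
have := le_trans bQ (lerD (Qinf_le n x (fun i => f0 (x i) + e i) (lam0 n) th1A) (lexx _)).
rewrite !Qtilde_sub th1E Jpen_pad//.
have noise1 := net_noise T0 bK (hth n).
have noise2 := net_noise T0 bK th1A.
rewrite th1E in noise2.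
set Sa := \sum_(i < n) (net d (r n) (th n) (x i) - f0 (x i)) ^+ 2.
set Sb := \sum_(i < n) (pif0 m (x i) - f0 (x i)) ^+ 2.
(* The terms [e i * f0 (x i)] cancel between estimator and competitor, so noise bounds are needed
   for networks only. *)
have -> : \sum_(i < n) e i * (net d (r n) (th n) (x i) - f0 (x i)) =
   \sum_(i < n) e i * net d (r n) (th n) (x i) - \sum_(i < n) e i * f0 (x i).
  by rewrite -sumrB; apply: eq_bigr => i _; rewrite mulrBr.
have -> : \sum_(i < n) e i * (pif0 m (x i) - f0 (x i)) =
   \sum_(i < n) e i * pif0 m (x i) - \sum_(i < n) e i * f0 (x i).
  by rewrite -sumrB; apply: eq_bigr => i _; rewrite mulrBr.
have Sb_le : n%:R^-1 * Sb <= a ^+ 2 / 4.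
  rewrite mulrC ler_pdivrMr// mulr_natr -[X in _ *+ X](card_ord n) -sumr_const.
  apply: ler_sum => i _; rewrite -real_normK ?num_real//.
  have := hm (x i) (xXc i) => h.
  apply: (@le_trans _ _ ((a / 2) ^+ 2)); last by rewrite expr_div_n; lra.
  by rewrite lerXn2r// nnegrE divr_ge0// ltW.
have JS : 0 <= lam n * Jpen d (r n) (th n) by rewrite mulr_ge0// Jpen_ge0.
have TE : n%:R^-1 * (V n * (3 * T)) * 4 <= a ^+ 2 / 4.
  apply: le_trans bS; rewrite le_eqVlt; apply/orP; left; apply/eqP.
  rewrite ger0_norm ?mulr_ge0 ?sqrtr_ge0//.
  have V0 : 0 < V n by rewrite (lt_trans _ (hV1 n)).
  have -> : V n ^+ 2 * ln n.+1%:R / n%:R = (V n / n%:R) ^+ 2 * (n%:R * ln n.+1%:R).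
    by field; rewrite gt_eqF.
  rewrite sqrtrM ?sqr_ge0// sqrtr_sqr ger0_norm; last by rewrite divr_ge0// ltW.
  by rewrite /T; ring.
have {}noise1 := ler_wpM2l (ltW (_ : 0 < n%:R^-1)) noise1.
have {}noise2 := ler_wpM2l (ltW (_ : 0 < n%:R^-1)) noise2.
have n1 : 0 < n%:R^-1 :> R by rewrite invr_gt0.
have := noise1 n1; have := noise2 n1.
rewrite -[X in X * `|_|](gtr0_norm n1) -[X in _ -> X * `|_| <= _ -> _](gtr0_norm n1).
rewrite -!normrM !ler_norml => /andP[q1 q2] /andP[q3 q4] main.
move: bJ bE; rewrite !ler_norml => /andP[_ bJ] /andP[_ bE].
have Sa_le : n%:R^-1 * Sa <= a ^+ 2.
  move: main; rewrite !mulrBr; lra.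
apply/andP; split; first by rewrite (le_trans _ (sqrtr_ge0 _))// oppr_le0 ltW.
by rewrite /emp_norm -[leRHS](ger0_norm (ltW a0)) -sqrtr_sqr ler_sqrt// sqr_ge0.
Unshelve. all: by end_near. Qed.

(** * Assembly of the probabilistic and deterministic halves *)

Theorem theorem4 (R : realType) (d0 : measure_display) (Omega : measurableType d0)
  (P : probability Omega R) (d : nat) (hd : (0 < d)%N)
  (Xc : set 'rV[R]_d) (hXc : compact Xc)
  (X : nat -> 'I_d -> {RV P >-> R}) (eps : nat -> {RV P >-> R})
  (f0 : 'rV[R]_d -> R)
  (* independence of X_1, X_2, ..., eps_1, eps_2, ... *)
  (hind : mutual_indep P (fun k : nat + nat =>
           match k with
           | inl i => rect_events d (fun j => (X i j : Omega -> R))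
           | inr i => rv_events (eps i : Omega -> R)
           end))
  (* identically distributed *)
  (hidX : forall i (B : 'I_d -> set R), (forall j, measurable (B j)) ->
     P (\big[setI/setT]_(j < d) ((X i j : Omega -> R) @^-1` B j))
     = P (\big[setI/setT]_(j < d) ((X 0%N j : Omega -> R) @^-1` B j)))
  (hideps : forall i (B : set R), measurable B ->
     P ((eps i : Omega -> R) @^-1` B) = P ((eps 0%N : Omega -> R) @^-1` B))
  (* X_i takes values in the compact set Xc *)
  (hXsupp : forall i, {ae P, forall w, (\row_j X i j w) \in Xc})
  (* noise assumptions *)
  (heps0 : ('E_P[eps 0%N] = 0)%E)
  (p : R) (hp : 2 <= p)
  (htail : (\int[lebesgue_measure]_(t in `[0%R, +oo[%classic)
             ((fine (P [set w | t < `|(eps 0%N : Omega -> R) w|])) `^ p^-1)%:E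
             < +oo)%E)
  (* sieve parameters *)
  (r : nat -> nat) (V M : nat -> R)
  (hr : (fun n => (r n)%:R : R) @ \oo --> +oo)
  (hV : V @ \oo --> +oo) (hM : M @ \oo --> +oo)
  (hV1 : forall n, 1 < V n) (hM0 : forall n, 0 < M n)
  (hnest : forall n, Fnet d (r n) (V n) (M n) `<=` Fnet d (r n.+1) (V n.+1) (M n.+1))
  (pif0 : nat -> 'rV[R]_d -> R)
  (hpif : forall n, Fnet d (r n) (V n) (M n) (pif0 n))
  (hpif_cvg : forall e : R, 0 < e -> \forall n \near \oo,
     forall x, Xc x -> `|pif0 n x - f0 x| <= e)
  (hrate : (fun n => (r n)%:R * V n ^+ 2 * ln ((r n)%:R * V n) / n%:R) @ \oo --> 0)
  (eta : nat -> R) (heta0 : forall n, 0 <= eta n) (heta : eta @ \oo --> 0) :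
  forall delta : R, 0 < delta -> exists nu : R, 0 < nu /\
  forall (lam : nat -> R), (forall n, 0 <= lam n) ->
  (fun n => lam n / Num.min ((r n)%:R `^ (- 2^-1))
                            ((r n)%:R `^ (- ((nu - 1) / (2 * nu))))) @ \oo --> 0 ->
  forall (fhat : nat -> Omega -> nnparam R) (C : R),
  (forall n w, admissible d (r n) (V n) (M n) (fhat n w)) ->
  (\forall n \near \oo, forall w,
     Qtilde d (r n) n (lam n) (fun i => \row_j X i j w)
            (fun i => f0 (\row_j X i j w) + eps i w) (fhat n w)
     <= Qinf d (r n) n (V n) (M n) (lam n) (fun i => \row_j X i j w)
            (fun i => f0 (\row_j X i j w) + eps i w) + C * eta n) ->
  exists A : set Omega, measurable A /\ ((1 - delta)%:E <= P A)%E /\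
    forall w, A w ->
      (fun n => emp_norm d n (fun i => \row_j X i j w)
                  (fun x => net d (r n) (fhat n w) x - f0 x)) @ \oo --> 0.
Proof.
(* With [nu] equal to 1 the second exponent is 0, and the factor [r^(-1/2)] already forces [lam] to
   tend to 0. *)
move=> delta delta0; exists 1; split => // lam lam0 hlam fhat C hadm hQ.
have [s2 s2E] := second_moment_fin hp htail.
have [A [K [mA pA K0 AK]]] := noise_event hind hideps heps0 s2E delta0.
(* A measurable null set contains all paths on which some design point leaves [Xc]. *)
have [N [mN PN sN]] : P.-negligible
    (\bigcup_i ~` [set w | (\row_j X i j w) \in Xc]).
  by apply: negligible_bigcup => i; exact: hXsupp.
have lam_cvg := lambda_cvg0 hr lam0 hlam.
exists (A `&` ~` N); split; first by apply: measurableI => //; exact: measurableC.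
split.
  (* Removing the null set costs no probability, since [A] is covered by its remaining part and
     [N]. *)
  apply: (le_trans pA); apply: (@le_trans _ _ (P ((A `&` ~` N) `|` N))).
    apply: le_measure; rewrite ?inE//.
      by apply: measurableU => //; apply: measurableI => //; exact: measurableC.
    by move=> w Aw; have [?|?] := pselect (N w); [right|left].
  apply: (le_trans (measureU2 _ _ _)) => //.
    by apply: measurableI => //; exact: measurableC.
  by rewrite [X in (_ + X)%E]PN adde0.
move=> w [Aw nN].
apply: (emp_norm_cvg0 (Xc := Xc) (K := K) (C := C) (e := fun i => eps i w) hr hV hM hV1 hM0
  hpif hpif_cvg hrate heta lam0 lam_cvg (fun n => hadm n w)) => //.
- by apply: filterS hQ => n; exact.
- move=> i; apply: contrapT => h; apply: nN; apply: sN; exists i => //=.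
  by rewrite inE.
- apply: filterS (AK w Aw) => n patK S [g [b gb]]; apply: patK; exists g, b => i.
  by rewrite gb; under eq_bigr do rewrite mxE.
Qed.
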